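(* Let $B$ be a unital $C^*$-algebra and let $S\subset B$ be an operator system such that $B=C^*(S)$. Let $\phi,\psi$ be states on $B$ such that $\phi$ is absolutely continuous with respect to $\psi$. If $\psi$ is $\mathcal{D}(S,B)$-maximal, then so is $\phi$.
   Context: An operator system $S\subset B$ is a unital self-adjoint linear subspace; $C^*(S)$ is the $C^*$-algebra it generates. $\mathcal{E}(B)$ denotes the state space of $B$. A representation of a state $\phi$ on $B$ is a triple $(\pi,H,\xi)$ consisting of a unital $*$-representation $\pi:B\to B(H)$ and a unit vector $\xi\in H$ (not necessarily cyclic) with $\phi(b)=\langle \pi(b)\xi,\xi\rangle$ for all $b\in B$. Dilation order: $\mathcal{D}(S,B)\subset \mathcal{E}(B)\times\mathcal{E}(B)$ is the set of pairs of states $(\phi,\psi)$ for which there are representations $(\pi,H,\xi)$ of $\phi$ and $(\sigma,K,\eta)$ of $\psi$, and an isometry $V:H\to K$ with $V\xi=\eta$, such that $\pi(a)=V^*\sigma(a)V$ for all $a\in S$. This is a partial order on $\mathcal{E}(B)$. A state $\phi$ is $\mathcal{D}(S,B)$-maximal if $(\phi,\psi)\in\mathcal{D}(S,B)$ implies $\psi=\phi$. Absolute continuity: for a state $\phi$ on $B$ (extended to the von Neumann algebra $B^{**}$ by weak-$*$ continuity) let $L_\phi=\{x\in B^{**}:\phi(x^*x)=0\}$. The state $\phi$ is absolutely continuous with respect to the state $\psi$ if $L_\psi\subset L_\phi$. *)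

(* Defs.v *)
From HB Require Import structures.
From mathcomp Require Import all_boot all_order all_algebra.
From mathcomp Require Import complex.
From mathcomp Require Import boolp classical_sets functions reals topology normedtype.

Set Implicit Arguments.
Unset Strict Implicit.
Unset Printing Implicit Defensive.

Import Order.TTheory GRing.Theory Num.Theory.
Import numFieldNormedType.Exports.

Local Open Scope classical_set_scope.
Local Open Scope ring_scope.

(* The inner product is linear in its first argument and conjugate-linear in
   its second. *)
HB.mixin Record isHilbert (R : realType) H & CompleteNormedModule R[i] H := {
  inner : {dot H for (@Num.conj R[i])};
  inner_norm : forall x : H, inner x x = `|x| ^+ 2 }.

#[short(type="hilbertType")]
HB.structure Definition Hilbert (R : realType) :=
  {H of isHilbert R H & CompleteNormedModule R[i] H}.

(* Unital C*-algebras. The ring operations are fields here, and the ring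
   structure is recovered as an instance below, because Hierarchy Builder does
   not allow a structure joining a normed module over an arbitrary field with
   a ring when it is declared after numDomainType. *)
HB.mixin Record isCStarAlgebra (R : realType) B & CompleteNormedModule R[i] B := {
  cmul : B -> B -> B;
  cone : B;
  cmulA : associative cmul;
  cmul1l : left_id cone cmul;
  cmul1r : right_id cone cmul;
  cmulDl : left_distributive cmul +%R;
  cmulDr : right_distributive cmul +%R;
  cscaleAl : forall (k : R[i]) x y, k *: cmul x y = cmul (k *: x) y;
  cscaleAr : forall (k : R[i]) x y, k *: cmul x y = cmul x (k *: y);
  star : B -> B;
  starD : {morph star : x y / x + y};
  starZ : forall (k : R[i]) x, star (k *: x) = k^* *: star x;
  starM : forall x y, star (cmul x y) = cmul (star y) (star x);
  starK : involutive star;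
  cnormM : forall x y, `|cmul x y| <= `|x| * `|y|;
  cnorm_star : forall x, `|cmul (star x) x| = `|x| ^+ 2 }.

#[short(type="cstarAlgType")]
HB.structure Definition CStarAlgebra (R : realType) :=
  {B of isCStarAlgebra R B & CompleteNormedModule R[i] B}.

#[non_forgetful_inheritance]
HB.instance Definition _ (R : realType) (B : cstarAlgType R) :=
  GRing.Zmodule_isPzRing.Build B (@cmulA R B) (@cmul1l R B) (@cmul1r R B)
    (@cmulDl R B) (@cmulDr R B).

(* blin E F is the normed space of bounded linear maps E -> F, with the operator
   norm; dual E below is the topological dual, so bidual E is the bidual Banach space. *)
Section BoundedLinear.
Variable R : realType.
Implicit Types E F : normedModType R[i].

Record blin E F := BLin {
  blin_fun :> E -> F;
  blin_linear : linear blin_fun;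
  blin_continuous : continuous blin_fun }.

HB.instance Definition _ E F (f : blin E F) :=
  GRing.isLinear.Build R[i] E F *:%R f (blin_linear f).

HB.instance Definition _ E F := gen_eqMixin (blin E F).
HB.instance Definition _ E F := gen_choiceMixin (blin E F).

Lemma blinP E F (f g : blin E F) : f =1 g -> f = g.
Proof.
case: f g => [f lf cf] [g lg cg] /= /funext fg; case: _ / fg in lg cg *.
by congr BLin; exact: Prop_irrelevance.
Qed.

Section Ops.
Variables E F : normedModType R[i].
Implicit Types f g : blin E F.

Let add_linear f g : linear (fun x => f x + g x).
Proof. by move=> k x y /=; rewrite !linearP scalerDr addrACA. Qed.

Let add_cont f g : continuous (fun x => f x + g x).
Proof. by move=> x; apply: cvgD; exact: blin_continuous. Qed.

Let scale_linear (k : R[i]) f : linear (fun x => k *: f x).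
Proof. by move=> l x y /=; rewrite linearP scalerDr !scalerA mulrC. Qed.

Let scale_cont (k : R[i]) f : continuous (fun x => k *: f x).
Proof. by move=> x; apply: cvgZr; exact: blin_continuous. Qed.

Let zero_linear : linear (fun _ : E => 0 : F).
Proof. by move=> k x y; rewrite scaler0 addr0. Qed.

Let zero_cont : continuous (fun _ : E => 0 : F).
Proof. by move=> x; exact: cvg_cst. Qed.

Definition blin_add f g := BLin (add_linear f g) (@add_cont f g).
Definition blin_scale k f := BLin (scale_linear k f) (@scale_cont k f).
Definition blin_zero := BLin zero_linear zero_cont.
Definition blin_opp f := blin_scale (-1) f.

Let addA : associative blin_add.
Proof. by move=> f g h; apply: blinP => x /=; rewrite addrA. Qed.
Let addC : commutative blin_add.
Proof. by move=> f g; apply: blinP => x /=; rewrite addrC. Qed.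
Let add0 : left_id blin_zero blin_add.
Proof. by move=> f; apply: blinP => x /=; rewrite add0r. Qed.
Let addN : left_inverse blin_zero blin_opp blin_add.
Proof. by move=> f; apply: blinP => x /=; rewrite scaleN1r addNr. Qed.

HB.instance Definition _ := GRing.isZmodule.Build (blin E F) addA addC add0 addN.

Let scaleA k l f : blin_scale k (blin_scale l f) = blin_scale (k * l) f.
Proof. by apply: blinP => x /=; rewrite scalerA. Qed.
Let scale1 : left_id 1 blin_scale.
Proof. by move=> f; apply: blinP => x /=; rewrite scale1r. Qed.
Let scaleDr : right_distributive blin_scale +%R.
Proof. by move=> k f g; apply: blinP => x /=; rewrite scalerDr. Qed.
Let scaleDl f : {morph blin_scale^~ f : a b / a + b}.
Proof. by move=> k l; apply: blinP => x /=; rewrite scalerDl. Qed.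

HB.instance Definition _ :=
  GRing.Zmodule_isLmodule.Build R[i] (blin E F) scaleA scale1 scaleDr scaleDl.

Definition opnorm f : R :=
  sup [set complex.Re `|f x| | x in [set x : E | `|x| <= 1]].

Let normE (G : normedModType R[i]) (x : G) : `|x| = (complex.Re `|x|)%:C%C.
Proof. by rewrite RRe_real// ger0_real. Qed.

Lemma opnorm_has_sup f :
  has_sup [set complex.Re `|f x| | x in [set x : E | `|x| <= 1]].
Proof.
split; first by exists (complex.Re `|f 0|), 0 => //=; rewrite normr0.
have /linear_boundedP/pinfty_ex_gt0[r r0 fr] :=
  (@continuous_linear_bounded _ _ _ 0 f (@blin_continuous E F f 0)).
exists (complex.Re r) => _ [x /= x1 <-].
rewrite -lecR -normE RRe_real ?gtr0_real//.
by rewrite (le_trans (fr x))// ler_piMr// ltW.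
Qed.

Lemma opnorm_ge0 f : 0 <= opnorm f.
Proof.
have -> : 0 = complex.Re `|f 0| by rewrite raddf0 normr0.
apply: ub_le_sup; first by case: (opnorm_has_sup f).
by exists 0 => //=; rewrite normr0.
Qed.

Lemma opnorm_bound f x : `|f x| <= (opnorm f)%:C%C * `|x|.
Proof.
have [->|x0] := eqVneq x 0; first by rewrite raddf0 !normr0 mulr0.
have nx : 0 < `|x| by rewrite normr_gt0.
have : complex.Re `|f (`|x|^-1 *: x)| <= opnorm f.
  apply: ub_le_sup; first by case: (opnorm_has_sup f).
  exists (`|x|^-1 *: x) => //=.
  by rewrite normrZ normfV normr_id mulVf// gt_eqF.
rewrite -lecR -normE linearZ/= normrZ normfV normr_id.
by rewrite ler_pdivrMl// mulrC.
Qed.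

Lemma opnorm_le f (M : R) :
  (forall x, `|x| <= 1 -> `|f x| <= M%:C%C) -> opnorm f <= M.
Proof.
move=> fM; apply: ge_sup; first by case: (opnorm_has_sup f).
by move=> _ [x /= x1 <-]; rewrite -lecR -normE; exact: fM.
Qed.

Let norm f : R[i] := (opnorm f)%:C%C.

Let norm_bound1 f x : `|x| <= 1 -> `|f x| <= norm f.
Proof.
move=> x1; rewrite (le_trans (opnorm_bound f x))// ler_piMr//.
by rewrite lecR opnorm_ge0.
Qed.

Let norm_le f (M : R[i]) : 0 <= M ->
  (forall x, `|x| <= 1 -> `|f x| <= M) -> norm f <= M.
Proof.
move=> M0 fM; rewrite -(RRe_real (ger0_real M0)) lecR; apply: opnorm_le => x x1.
by rewrite RRe_real ?ger0_real//; exact: fM.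
Qed.

Let norm_ge0 f : 0 <= norm f. Proof. by rewrite lecR opnorm_ge0. Qed.

Let normD f g : norm (f + g) <= norm f + norm g.
Proof.
apply: norm_le => [|x x1]; first by rewrite addr_ge0.
by rewrite (le_trans (ler_normD _ _))// lerD// norm_bound1.
Qed.

Let normZ_le k f : norm (k *: f) <= `|k| * norm f.
Proof.
apply: norm_le => [|x x1]; first by rewrite mulr_ge0.
by rewrite normrZ ler_wpM2l// norm_bound1.
Qed.

Let normZ (k : R[i]) f : norm (k *: f) = `|k| * norm f.
Proof.
apply/le_anti; rewrite normZ_le /=.
have [->|k0] := eqVneq k 0; first by rewrite normr0 mul0r.
rewrite -ler_pdivlMl ?normr_gt0// -normfV (le_trans _ (normZ_le _ _))//.
by rewrite scalerA mulVf// scale1r.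
Qed.

Let norm0_eq0 f : norm f = 0 -> f = 0.
Proof.
move=> f0; apply: blinP => x /=; apply/normr0_eq0/le_anti.
by rewrite normr_ge0 andbT (le_trans (opnorm_bound f x))// -/(norm f) f0 mul0r.
Qed.

HB.instance Definition _ :=
  Lmodule_isNormed.Build R[i] (blin E F) normD normZ norm0_eq0.

Lemma blin_normE f : `|f| = (opnorm f)%:C%C. Proof. by []. Qed.

End Ops.
End BoundedLinear.

Section Continuity.
Variables (R : realType) (E F G : normedModType R[i]).

Lemma blin_bound (f : blin E F) x : `|f x| <= `|f| * `|x|.
Proof. by rewrite blin_normE; exact: opnorm_bound. Qed.

Lemma blin_norm_le (f : blin E F) (M : R[i]) : 0 <= M ->
  (forall x, `|f x| <= M * `|x|) -> `|f| <= M.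
Proof.
move=> M0 fM; rewrite blin_normE -(RRe_real (ger0_real M0)) lecR.
apply: opnorm_le => x x1; rewrite RRe_real ?ger0_real//.
by rewrite (le_trans (fM x))// ler_piMr.
Qed.

Lemma bounded_continuous (f : E -> F) (M : R[i]) : linear f ->
  (forall x, `|f x| <= M * `|x|) -> continuous f.
Proof.
move=> lf fM.
pose g : {linear E -> F} := HB.pack f (GRing.isLinear.Build R[i] E F *:%R f lf).
apply: (@bounded_linear_continuous _ _ _ g); apply/linear_boundedP.
have fM' x : `|f x| <= `|M| * `|x|.
  have M0 : 0 <= M * `|x| by exact: le_trans (fM x).
  by rewrite -(normr_id x) -normrM ger0_norm.
near=> r => x; rewrite (le_trans (fM' x))// ler_wpM2r//.
by near: r; apply: nbhs_pinfty_ge; exact: normr_real.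
Unshelve. all: by end_near. Qed.

Let comp_linear (g : blin F G) (f : blin E F) : linear (g \o f).
Proof. by move=> k x y /=; rewrite !linearP. Qed.

Let comp_cont (g : blin F G) (f : blin E F) : continuous (g \o f).
Proof. by move=> x; apply: continuous_comp; exact: blin_continuous. Qed.

Definition blin_comp g f := BLin (comp_linear g f) (@comp_cont g f).

Let id_linear : linear (@idfun E). Proof. by []. Qed.
Let id_cont : continuous (@idfun E). Proof. by move=> x; exact: cvg_id. Qed.

Definition blin_id := BLin id_linear id_cont.

End Continuity.
Arguments blin_id {R E}.

Notation dual E := (blin E (_[i]^o)).
Notation bidual E := (dual (dual E)).

Section Bidual.
Variables (R : realType) (B : cstarAlgType R).
Implicit Types (a b : B) (f : dual B) (x y : bidual B).

Lemma star_norm a : `|star a| = `|a|.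
Proof.
suff le b : `|b| <= `|star b| by apply/le_anti; rewrite le -{2}(starK a) le.
have [->|b0] := eqVneq b 0; first by rewrite normr0.
by rewrite -(ler_pM2r (x := `|b|)) ?normr_gt0// -expr2 -cnorm_star cnormM.
Qed.

Let dual_act_linear f a : linear (fun b => f (a * b) : R[i]^o).
Proof.
by move=> k b c /=; rewrite mulrDr -[a * (k *: b)]/(cmul a (k *: b)) -cscaleAr linearP.
Qed.

Let dual_act_bound f a b : `|f (a * b)| <= `|f| * `|a| * `|b|.
Proof.
by rewrite (le_trans (blin_bound _ _))// -mulrA ler_wpM2l// cnormM.
Qed.

(* (f . a)(b) = f (a b) *)
Definition dual_act f a : dual B :=
  BLin (dual_act_linear f a)
    (bounded_continuous (dual_act_linear f a) (dual_act_bound f a)).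

Let dual_act_norm f a : `|dual_act f a| <= `|f| * `|a|.
Proof. by apply: blin_norm_le; [rewrite mulr_ge0|exact: dual_act_bound]. Qed.

Let bidual_act_linear x f : linear (fun a => x (dual_act f a) : R[i]^o).
Proof.
move=> k a b; rewrite -linearP; congr (x _); apply: blinP => c /=.
by rewrite mulrDl -[(k *: a) * c]/(cmul (k *: a) c) -cscaleAl linearP.
Qed.

Let bidual_act_bound x f a : `|x (dual_act f a)| <= `|x| * `|f| * `|a|.
Proof. by rewrite (le_trans (blin_bound _ _))// -mulrA ler_wpM2l ?dual_act_norm. Qed.

(* (x . f)(a) = x (f . a) *)
Definition bidual_act x f : dual B :=
  BLin (bidual_act_linear x f)
    (bounded_continuous (bidual_act_linear x f) (bidual_act_bound x f)).

Let bidual_act_norm x f : `|bidual_act x f| <= `|x| * `|f|.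
Proof. by apply: blin_norm_le; [rewrite mulr_ge0|exact: bidual_act_bound]. Qed.

Let bidual_mul_linear x y : linear (fun f => x (bidual_act y f) : R[i]^o).
Proof.
move=> k f g; rewrite -linearP; congr (x _); apply: blinP => a /=.
by rewrite -linearP; congr (y _); apply: blinP.
Qed.

Let bidual_mul_bound x y f : `|x (bidual_act y f)| <= `|x| * `|y| * `|f|.
Proof. by rewrite (le_trans (blin_bound _ _))// -mulrA ler_wpM2l ?bidual_act_norm. Qed.

(* The first Arens product (x y)(f) = x (y . f). C*-algebras are Arens regular,
   and this is the product of the enveloping von Neumann algebra. *)
Definition bidual_mul x y : bidual B :=
  BLin (bidual_mul_linear x y)
    (bounded_continuous (bidual_mul_linear x y) (bidual_mul_bound x y)).

Let dual_star_linear f : linear (fun a => (f (star a))^* : R[i]^o).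
Proof.
by move=> k a b; rewrite starD starZ linearP rmorphD/= rmorphM/= conjCK.
Qed.

Let dual_star_bound f a : `|(f (star a) : R[i])^*| <= `|f| * `|a|.
Proof. by rewrite norm_conjC -(star_norm a); exact: blin_bound. Qed.

(* The involution of B passes to the dual by f |-> (a |-> conj (f (star a))), and
   in the same way from the dual to the bidual. *)
Definition dual_star f : dual B :=
  BLin (dual_star_linear f)
    (bounded_continuous (dual_star_linear f) (dual_star_bound f)).

Let dual_star_norm f : `|dual_star f| <= `|f|.
Proof. by apply: blin_norm_le; [|exact: dual_star_bound]. Qed.

Let bidual_star_linear x : linear (fun f => (x (dual_star f))^* : R[i]^o).
Proof.
move=> k f g.
have -> : dual_star (k *: f + g) = k^* *: dual_star f + dual_star g.
  by apply: blinP => a /=; rewrite rmorphD rmorphM.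
by rewrite linearP rmorphD/= rmorphM/= conjCK.
Qed.

Let bidual_star_bound x f : `|(x (dual_star f) : R[i])^*| <= `|x| * `|f|.
Proof.
by rewrite norm_conjC (le_trans (blin_bound _ _))// ler_wpM2l ?dual_star_norm.
Qed.

Definition bidual_star x : bidual B :=
  BLin (bidual_star_linear x)
    (bounded_continuous (bidual_star_linear x) (bidual_star_bound x)).

Let to_bidual_linear a : linear (fun f => f a : R[i]^o).
Proof. by []. Qed.

Let to_bidual_bound a f : `|f a| <= `|a| * `|f|.
Proof. by rewrite mulrC; exact: blin_bound. Qed.

(* The canonical embedding of B into its bidual. *)
Definition to_bidual a : bidual B :=
  BLin (to_bidual_linear a)
    (bounded_continuous (to_bidual_linear a) (to_bidual_bound a)).

Lemma to_bidualE f a : to_bidual a f = f a. Proof. by []. Qed.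

Lemma to_bidualM a b :
  to_bidual (a * b) = bidual_mul (to_bidual a) (to_bidual b).
Proof. exact: blinP. Qed.

Lemma to_bidual_star a : to_bidual (star a) = bidual_star (to_bidual a).
Proof. by apply: blinP => f /=; rewrite conjCK. Qed.

End Bidual.

Section States.
Variables (R : realType) (B : cstarAlgType R).
Implicit Types (S A : set B) (f phi psi : dual B).

(* Positive functionals are automatically bounded, so taking states inside
   dual B loses nothing. *)
Definition is_state phi : Prop :=
  (forall b, 0 <= (phi (star b * b) : R[i])) /\ phi 1 = 1.

(* The functionals x |-> x f, for f in the dual, are exactly the weak-*
   continuous functionals on the bidual; this is the one that extends phi. *)
Definition bidual_ext phi (x : bidual B) : R[i] := x phi.

Definition null_ideal phi : set (bidual B) :=
  [set x | bidual_ext phi (bidual_mul (bidual_star x) x) = 0].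

Definition absolutely_continuous phi psi : Prop :=
  null_ideal psi `<=` null_ideal phi.

Definition linear_subspace S : Prop :=
  S 0 /\ forall (k : R[i]) a b, S a -> S b -> S (k *: a + b).

Definition self_adjoint S : Prop := forall a, S a -> S (star a).

Definition operator_system S : Prop :=
  [/\ linear_subspace S, self_adjoint S & S 1].

Definition cstar_subalgebra A : Prop :=
  [/\ linear_subspace A, self_adjoint A,
      forall a b, A a -> A b -> A (a * b) & closed A].

Definition cstar_generated S : set B :=
  \bigcap_(A in [set A | cstar_subalgebra A /\ S `<=` A]) A.

(* T' is the Hilbert space adjoint of T; it exists and is unique for every T. *)
Definition is_adjoint (H K : hilbertType R) (T : blin H K) (T' : blin K H) :
    Prop :=
  forall x y, inner (T x) y = inner x (T' y).

Record star_representation (H : hilbertType R) (pi : B -> blin H H) : Prop := {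
  repr_linear : linear pi;
  repr1 : pi 1 = blin_id;
  reprM : forall a b, pi (a * b) = blin_comp (pi a) (pi b);
  repr_star : forall a, is_adjoint (pi a) (pi (star a)) }.

Definition represents phi (H : hilbertType R) (pi : B -> blin H H) (xi : H) :
    Prop :=
  [/\ star_representation pi, `|xi| = 1 &
      forall b, phi b = inner (pi b xi) xi].

Definition dilation_order S phi psi : Prop :=
  [/\ is_state phi, is_state psi &
      exists (H K : hilbertType R) (pi : B -> blin H H) (xi : H)
             (sigma : B -> blin K K) (eta : K) (V : blin H K) (Vstar : blin K H),
        [/\ represents phi pi xi, represents psi sigma eta,
            (forall x, `|V x| = `|x|) /\ V xi = eta, is_adjoint V Vstar &
            forall a, S a -> pi a = blin_comp Vstar (blin_comp (sigma a) V)]].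

Definition dilation_maximal S phi : Prop :=
  forall psi, dilation_order S phi psi -> psi = phi.

End States.

(* Main.v *)
Require Import Defs.
From HB Require Import structures.
From mathcomp Require Import all_boot all_order all_algebra complex ring lra.
From mathcomp Require Import boolp classical_sets reals interval_inference.
From mathcomp Require Import topology normedtype sequences.

(* Suppose (phi, chi) lies in the dilation order, through a dilation of a
   representation of phi with vector xi. A vector z is intertwined when the
   dilated representation acts on V z as V composed with the original one; if xi
   is intertwined then chi = phi. When psi is maximal, every vector z representing
   psi is intertwined: |sigma(b) V z|^2 and |pi(b) z|^2 are the values of the
   dilated state and of psi at b* b, so they agree, and for a in S equality of
   norms turns V* sigma(a) V = pi(a) into sigma(a) V = V pi(a) along the orbit of
   z. Adjoining a GNS summand for psi - c omega_z extends this to all z whose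
   vector functional omega_z is bounded by a multiple of psi ("dominated").

   Adjoin further a vector e representing psi, and let f be the component of xi
   orthogonal to the orbits of all dominated vectors. If f = 0 then xi is a limit
   of intertwined vectors. Projections onto orbit closures preserve dominated
   vectors, so a double commutant argument yields selfadjoint b_n with
   b_n xi -> f, b_n f -> f and b_n e -> 0. The elements z_n = (b_n + i)^-1 b_n are
   bounded, z_n e -> 0 and z_n xi -> (1 + i)^-1 f. A weak-* limit x of z_n in the
   bidual satisfies psi (x* x) = 0 and phi (x* x) = |f|^2 / 2, hence f = 0 by
   absolute continuity. *)

Set Implicit Arguments.
Unset Strict Implicit.
Unset Printing Implicit Defensive.

Import Order.TTheory GRing.Theory Num.Theory.
Import numFieldNormedType.Exports.

Local Open Scope classical_set_scope.
Local Open Scope ring_scope.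

Local Notation Re := complex.Re.
Local Notation Im := complex.Im.

(** * Semi-inner products *)

Section ComplexReals.
Variable R : realType.
Implicit Types (z w : R[i]).

Definition normsq z : R := Re z ^+ 2 + Im z ^+ 2.

Lemma complexP z w : Re z = Re w -> Im z = Im w -> z = w.
Proof. by case: z w => [a b] [c d] /= -> ->. Qed.

Lemma cReC z : Re z^* = Re z. Proof. by case: z. Qed.
Lemma cImC z : Im z^* = - Im z. Proof. by case: z. Qed.
Lemma cReM z w : Re (z * w) = Re z * Re w - Im z * Im w.
Proof. by case: z w => [a b] [c d]. Qed.
Lemma cImM z w : Im (z * w) = Re z * Im w + Im z * Re w.
Proof. by case: z w => [a b] [c d]. Qed.

Lemma normsq_ge0 z : 0 <= normsq z.
Proof. by rewrite addr_ge0 ?sqr_ge0. Qed.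

Lemma normsq_eq0 z : normsq z = 0 -> z = 0.
Proof.
move=> /eqP; rewrite paddr_eq0 ?sqr_ge0// !sqrf_eq0 => /andP[/eqP r /eqP i].
exact: complexP.
Qed.

Lemma normsqM z w : normsq (z * w) = normsq z * normsq w.
Proof. by rewrite /normsq cReM cImM; ring. Qed.

Lemma normsqC z : normsq z^* = normsq z.
Proof. by rewrite /normsq cReC cImC sqrrN. Qed.

Lemma normsqN z : normsq (- z) = normsq z.
Proof. by rewrite /normsq !raddfN /= !sqrrN. Qed.

Lemma normsq_real (a : R) : normsq a%:C%C = a ^+ 2.
Proof. by rewrite /normsq /= expr0n addr0. Qed.

Lemma normsqE z : normsq z = Re `|z| ^+ 2.
Proof. by rewrite normc_def /= sqr_sqrtr// normsq_ge0. Qed.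

End ComplexReals.

Section Forms.
Variable R : realType.

Lemma natSinv_lt (e : R) : 0 < e ->
  exists N, forall n, (N <= n)%N -> n.+1%:R^-1 < e.
Proof.
by move=> /[dup] e0 /posnumP[d]; have [N _ H] := near_infty_natSinv_lt d; exists N.
Qed.

Lemma div4_gt0 (e : R) : 0 < e -> 0 < e / 4.
Proof. by move=> e0; rewrite divr_gt0. Qed.

(** Forms may be degenerate: the form [w (star y * x)] of a positive functional can have null
    vectors, so limits under [fcvg] are unique only up to vectors with [fq] zero. Positivity
    constrains the real part of [s x x] because [fsC] already makes its imaginary part vanish. *)
Record form (E : lmodType R[i]) := Form {
  fs :> E -> E -> R[i];
  fsP : forall z k x y, fs (k *: x + y) z = k * fs x z + fs y z;
  fsC : forall x y, fs y x = (fs x y)^*;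
  fs_ge0 : forall x, 0 <= Re (fs x x) }.

Section Theory.
Variables (E : lmodType R[i]) (s : form E).
Implicit Types (x y z : E) (k : R[i]) (u v : nat -> E).

Lemma fsDl x y z : s (x + y) z = s x z + s y z.
Proof. by rewrite -(scale1r x) fsP mul1r scale1r. Qed.
Lemma fs0l z : s 0 z = 0.
Proof. by apply: (addrI (s 0 z)); rewrite -fsDl !addr0. Qed.
Lemma fsZl k x z : s (k *: x) z = k * s x z.
Proof. by rewrite -[k *: x]addr0 fsP fs0l addr0. Qed.
Lemma fsNl x z : s (- x) z = - s x z.
Proof. by rewrite -scaleN1r fsZl mulN1r. Qed.
Lemma fsBl x y z : s (x - y) z = s x z - s y z.
Proof. by rewrite fsDl fsNl. Qed.
Lemma fsDr x y z : s z (x + y) = s z x + s z y.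
Proof. by rewrite fsC fsDl rmorphD/= -!fsC. Qed.
Lemma fs0r z : s z 0 = 0.
Proof. by rewrite fsC fs0l rmorph0. Qed.
Lemma fsZr k x z : s z (k *: x) = k^* * s z x.
Proof. by rewrite fsC fsZl rmorphM/= -!fsC. Qed.
Lemma fsNr x z : s z (- x) = - s z x.
Proof. by rewrite fsC fsNl rmorphN/= -!fsC. Qed.
Lemma fsBr x y z : s z (x - y) = s z x - s z y.
Proof. by rewrite fsDr fsNr. Qed.

Definition fq x : R := Re (s x x).

Lemma fq_ge0 x : 0 <= fq x. Proof. exact: fs_ge0. Qed.

Lemma fs_diag x : s x x = (fq x)%:C%C.
Proof.
apply: complexP => //=; have := congr1 (@Im R) (fsC s x x).
by rewrite cImC => /eqP; rewrite -addr_eq0 -mulr2n mulrn_eq0 /= => /eqP.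
Qed.

Lemma fq0 : fq 0 = 0. Proof. by rewrite /fq fs0l. Qed.
Lemma fqZ k x : fq (k *: x) = normsq k * fq x.
Proof.
by rewrite /fq fsZl fsZr fs_diag !cReM !cImM cReC cImC /normsq /=; ring.
Qed.
Lemma fqN x : fq (- x) = fq x.
Proof. by rewrite /fq fsNl fsNr opprK. Qed.
Lemma fqB x y : fq (x - y) = fq (y - x).
Proof. by rewrite -fqN opprB. Qed.
Lemma fqD x y : fq (x + y) = fq x + fq y + 2 * Re (s x y).
Proof.
rewrite /fq fsDl !fsDr !raddfD /= (fsC s x y) cReC; ring.
Qed.
Lemma fqBE x y : fq (x - y) = fq x + fq y - 2 * Re (s x y).
Proof. by rewrite fqD fqN fsNr raddfN mulrN. Qed.
Lemma fq_parallelogram x y : fq (x + y) + fq (x - y) = 2 * fq x + 2 * fq y.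
Proof. by rewrite fqD fqBE; ring. Qed.
Lemma fqD_le x y : fq (x + y) <= 2 * fq x + 2 * fq y.
Proof. by rewrite -fq_parallelogram lerDl fq_ge0. Qed.
Lemma fqB_le x y z : fq (x - z) <= 2 * fq (x - y) + 2 * fq (y - z).
Proof. by rewrite -[x - z](subrKA y) fqD_le. Qed.

Lemma fCS x y : normsq (s x y) <= fq x * fq y.
Proof.
have H (a : R[i]) : 0 <= fq x + normsq a * fq y - 2 * Re (a^* * s x y).
  by have := fq_ge0 (x - a *: y); rewrite fqBE fqZ fsZr.
have [q0|q0] := eqVneq (fq y) 0.
  set t := normsq (s x y); rewrite q0 mulr0 leNgt; apply/negP => t0.
  (* When [fq y = 0], this multiple makes the subtracted term [2 * (fq x + 1)], which exceeds
     [fq x]. *)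
  have := H (((fq x + 1) / t)%:C%C * s x y); rewrite q0 mulr0 addr0.
  rewrite rmorphM /= -mulrA [_^* * s x y]mulrC -/(_ * _) !cReM ?cImM !cReC !cImC /=.
  rewrite oppr0 mul0r subr0.
  have -> : Re (s x y) * Re (s x y) - Im (s x y) * - Im (s x y) = t.
    by rewrite /t /normsq; ring.
  rewrite divfK ?gt_eqF//; have := fq_ge0 x; lra.
have yp : 0 < fq y by rewrite lt_neqAle eq_sym q0 fq_ge0.
have := H ((fq y)^-1%:C%C * s x y).
rewrite normsqM normsq_real rmorphM /= !cReM !cImM !cReC !cImC /= oppr0 !mul0r !subr0 !addr0.
set t := normsq _.
have -> : (fq y)^-1 * Re (s x y) * Re (s x y) - (fq y)^-1 * - Im (s x y) * Im (s x y)
   = (fq y)^-1 * t by rewrite /t /normsq; ring.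
have -> : (fq y)^-1 ^+ 2 * t * fq y = (fq y)^-1 * t by field.
move=> h; rewrite mulrC -ler_pdivrMl//; lra.
Qed.

Lemma fs_null x y : fq x = 0 -> s x y = 0.
Proof.
move=> x0; apply: normsq_eq0; apply/le_anti.
by rewrite normsq_ge0 andbT (le_trans (fCS _ _))// x0 mul0r.
Qed.

Definition fcvg u x := forall e : R, 0 < e ->
  exists N, forall n, (N <= n)%N -> fq (u n - x) < e.

Definition fcauchy u := forall e : R, 0 < e ->
  exists N, forall m n, (N <= m)%N -> (N <= n)%N -> fq (u m - u n) < e.

Lemma fcvg_cst x : fcvg (fun=> x) x.
Proof. by move=> e e0; exists 0%N => n _; rewrite subrr fq0. Qed.

Lemma fcvgP (k : R[i]) u v x y : fcvg u x -> fcvg v y ->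
  fcvg (fun n => k *: u n + v n) (k *: x + y).
Proof.
move=> ux vy e e0.
have d0 : 0 < e / (4 * (normsq k + 1)).
  by rewrite divr_gt0// mulr_gt0// ltr_wpDl// normsq_ge0.
have [N1 H1] := ux _ d0.
have [N2 H2] := vy (e / 4) (div4_gt0 e0).
exists (maxn N1 N2) => n; rewrite geq_max => /andP[/H1 h1 /H2 h2].
rewrite opprD addrACA -scalerBr (le_lt_trans (fqD_le _ _))// fqZ.
have : (normsq k + 1) * fq (u n - x) < e / 4.
  by rewrite mulrC -ltr_pdivlMr ?ltr_wpDl ?normsq_ge0// -mulrA -invfM.
have := fq_ge0 (u n - x); lra.
Qed.

Lemma fcvgD u v x y : fcvg u x -> fcvg v y -> fcvg (fun n => u n + v n) (x + y).
Proof.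
by move=> /(fcvgP 1) /[apply]; rewrite scale1r; under eq_fun do rewrite scale1r.
Qed.

Lemma fcvgZ k u x : fcvg u x -> fcvg (fun n => k *: u n) (k *: x).
Proof.
move=> /(fcvgP k) /(_ (fcvg_cst 0)); rewrite addr0.
by under eq_fun do rewrite addr0.
Qed.

Lemma fcvgN u x : fcvg u x -> fcvg (fun n => - u n) (- x).
Proof. by move=> /(fcvgZ (-1)); rewrite scaleN1r; under eq_fun do rewrite scaleN1r. Qed.

Lemma fcvgB u v x y : fcvg u x -> fcvg v y -> fcvg (fun n => u n - v n) (x - y).
Proof. by move=> ux /fcvgN; exact: fcvgD. Qed.

Lemma fcvg_unique u x y : fcvg u x -> fcvg u y -> fq (x - y) = 0.
Proof.
move=> ux uy; apply/le_anti; rewrite fq_ge0 andbT leNgt; apply/negP => p.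
have p4 : 0 < fq (x - y) / 4 by rewrite divr_gt0.
have [N1 H1] := ux _ p4; have [N2 H2] := uy _ p4.
have := fqB_le x (u (maxn N1 N2)) y; rewrite (fqB x (u _)).
have := H1 _ (leq_maxl N1 N2); have := H2 _ (leq_maxr N1 N2); lra.
Qed.

Lemma fcvg_cauchy u x : fcvg u x -> fcauchy u.
Proof.
move=> ux e e0; have [N H] := ux (e / 4) (div4_gt0 e0).
exists N => m n /H hm /H hn; have := fqB_le (u m) x (u n); rewrite (fqB x); lra.
Qed.

Lemma fcvg_of_le u x (d : nat -> R) :
  (forall e : R, 0 < e -> exists N, forall n, (N <= n)%N -> d n < e) ->
  (forall n, fq (u n - x) <= d n) -> fcvg u x.
Proof.
move=> d0 ud e /d0[N H]; exists N => n /H; exact: le_lt_trans.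
Qed.

Lemma fcauchy_bounded u : fcauchy u -> exists M : R, 0 < M /\ forall n, fq (u n) <= M.
Proof.
move=> /(_ 1 ltr01) [N H].
exists (1 + 2 + \sum_(i < N.+1) 2 * fq (u i)).
have p (i : nat) : 0 <= 2 * fq (u i) by rewrite mulr_ge0 ?fq_ge0.
have sp (r : nat) : 0 <= \sum_(i < r) 2 * fq (u i) by apply: sumr_ge0 => i _; exact: p.
split; first by have := sp N.+1; lra.
move=> n; have [nN|Nn] := leqP n.+1 N.+1.
  rewrite (bigD1 (Ordinal nN)) //=.
  have : 0 <= \sum_(i < N.+1 | i != Ordinal nN) 2 * fq (u i).
    by apply: sumr_ge0 => i _; exact: p.
  have := fq_ge0 (u n); lra.
have hn := H n N (ltnW Nn) (leqnn _).
have := fqB_le (u n) (u N) 0; rewrite !subr0.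
by rewrite big_ord_recr /=; have := sp N; lra.
Qed.

Lemma fcauchyD u v : fcauchy u -> fcauchy v -> fcauchy (fun n => u n + v n).
Proof.
move=> cu cv e e0; have e4 : 0 < e / 4 by rewrite divr_gt0.
have [N1 H1] := cu _ e4; have [N2 H2] := cv _ e4.
exists (maxn N1 N2) => m n; rewrite !geq_max => /andP[m1 m2] /andP[n1 n2].
rewrite opprD addrACA; have := fqD_le (u m - u n) (v m - v n).
have := H1 _ _ m1 n1; have := H2 _ _ m2 n2; lra.
Qed.

End Theory.

Arguments fcvg_cst {E} s x.

Lemma scalar_formP (z k x y : R[i]^o) :
  (k *: x + y : R[i]) * z^* = k * ((x : R[i]) * z^*) + (y : R[i]) * z^*.
Proof. by rewrite mulrDl mulrA. Qed.

Lemma scalar_formC (x y : R[i]^o) : (y * x^* : R[i]) = ((x : R[i]) * y^*)^*.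
Proof. by rewrite rmorphM/= conjCK mulrC. Qed.

Lemma scalar_form_ge0 (x : R[i]^o) : 0 <= Re ((x : R[i]) * x^*).
Proof. by rewrite cReM cReC cImC mulrN opprK -!expr2 normsq_ge0. Qed.

(** Scalars viewed as vectors, so that the lemmas on [fcvg] and [fcauchy] also serve scalar
    sequences. *)
Definition cform : form R[i]^o := Form scalar_formP scalar_formC scalar_form_ge0.

Lemma cformE (x : R[i]) : fq cform x = normsq x.
Proof. by rewrite /fq /= cReM cReC cImC mulrN opprK. Qed.

Section TwoForms.
Variables (E : lmodType R[i]) (s : form E).

Lemma fcvg_map (E' : lmodType R[i]) (s' : form E') (T : E -> E') (M : R) u x :
  (forall x y, T (x - y) = T x - T y) -> (forall x, fq s' (T x) <= M * fq s x) ->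
  fcvg s u x -> fcvg s' (T \o u) (T x).
Proof.
move=> TB TM ux e e0.
have d0 : 0 < e / (`|M| + 1) by rewrite divr_gt0// ltr_wpDl.
have [N H] := ux _ d0; exists N => n /H; rewrite /= -TB => h.
apply: (le_lt_trans (TM _)); move: h; rewrite ltr_pdivlMr ?ltr_wpDl// mulrC.
have := fq_ge0 s (u n - x); have := ler_norm M; nra.
Qed.

Lemma fcauchy_map (E' : lmodType R[i]) (s' : form E') (T : E -> E') (M : R) u :
  (forall x y, T (x - y) = T x - T y) -> (forall x, fq s' (T x) <= M * fq s x) ->
  fcauchy s u -> fcauchy s' (T \o u).
Proof.
move=> TB TM ux e e0.
have d0 : 0 < e / (`|M| + 1) by rewrite divr_gt0// ltr_wpDl.
have [N H] := ux _ d0; exists N => m n /H/[apply]; rewrite /= -TB => h.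
apply: (le_lt_trans (TM _)); move: h; rewrite ltr_pdivlMr ?ltr_wpDl// mulrC.
have := fq_ge0 s (u m - u n); have := ler_norm M; nra.
Qed.

Lemma fcvg_fsl u x y : fcvg s u x -> fcvg cform (fun n => s (u n) y) (s x y).
Proof.
move=> ux; apply: (@fcvg_map _ cform (s^~ y) (fq s y) u x) => //.
  by move=> a b; rewrite fsBl.
by move=> a; rewrite cformE mulrC fCS.
Qed.

Lemma fcvg_fs u v x y : fcvg s u x -> fcvg s v y ->
  fcvg cform (fun n => s (u n) (v n)) (s x y).
Proof.
move=> ux vy.
have [M [M0 vM]] := fcauchy_bounded (fcvg_cauchy vy).
have -> : s x y = s x y + (s (x - x) y) by rewrite subrr fs0l addr0.
have -> : (fun n => s (u n) (v n)) = (fun n => s (u n - x) (v n) + s x (v n)).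
  by apply/funext => n; rewrite fsBl subrK.
rewrite addrC; apply: (@fcvgD _ cform) => e e0.
  have [N H] := ux (e / M) (divr_gt0 e0 M0); exists N => n /H h.
  rewrite subrr fs0l subr0 cformE (le_lt_trans (fCS _ _ _))//.
  move: h; rewrite ltr_pdivlMr//; apply: le_lt_trans.
  by rewrite ler_wpM2l ?fq_ge0.
have d0 : 0 < e / (fq s x + 1) by rewrite divr_gt0// ltr_wpDl ?fq_ge0.
have [N H] := vy _ d0; exists N => n /H h.
rewrite cformE -fsBr (le_lt_trans (fCS _ _ _))//.
move: h; rewrite ltr_pdivlMr ?ltr_wpDl ?fq_ge0//.
have := fq_ge0 s x; have := fq_ge0 s (v n - y); nra.
Qed.

End TwoForms.

Lemma ccvg_unique (u : nat -> R[i]) (x y : R[i]) :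
  fcvg cform u x -> fcvg cform u y -> x = y.
Proof.
move=> ux uy; apply/eqP; rewrite -subr_eq0; apply/eqP; apply: normsq_eq0.
by rewrite -cformE; exact: fcvg_unique ux uy.
Qed.

Lemma ccvg_Re (u : nat -> R[i]) x (a : R) :
  fcvg cform u x -> (forall n, a <= Re (u n)) -> a <= Re x.
Proof.
move=> ux au; rewrite leNgt; apply/negP => xa.
have p : 0 < (a - Re x) ^+ 2 by rewrite exprn_gt0// subr_gt0.
have [N /(_ _ (leqnn _))] := ux _ p; rewrite cformE /normsq !raddfB /=.
have := au N; have := sqr_ge0 (Im (u N) - Im x); nra.
Qed.

Lemma ccvg_conj (u : nat -> R[i]) x :
  fcvg cform u x -> fcvg cform (fun n => (u n)^*) x^*.
Proof.
by move=> ux e /ux[N H]; exists N => n /H; rewrite !cformE -rmorphB normsqC.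
Qed.

Lemma real_cauchy_cvg (u : nat -> R) :
  (forall e : R, 0 < e -> exists N, forall m n, (N <= m)%N -> (N <= n)%N ->
     `|u m - u n| < e) ->
  exists l : R, forall e : R, 0 < e -> exists N, forall n, (N <= n)%N -> `|u n - l| < e.
Proof.
move=> cu; have : cvgn u.
  apply: (@cauchy_cvg R^o); apply: cauchy_exP => e /cu[N H]; exists (u N).
  by exists N => // n /= Nn; rewrite -ball_normE /ball_ /=; exact: H.
move=> /cvg_ex[l /cvgrPdist_lt ul]; exists l => e /ul[N _ H]; exists N => n.
by move=> /H; rewrite distrC.
Qed.

Lemma ccomplete (u : nat -> R[i]) : fcauchy cform u -> exists l, fcvg cform u l.
Proof.
move=> cu.
have sq (a b e : R) : 0 < e -> a ^+ 2 + b ^+ 2 < e ^+ 2 -> `|a| < e /\ `|b| < e.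
  move=> e0 h; rewrite !ltr_norml; have := sqr_ge0 a; have := sqr_ge0 b.
  by split; apply/andP; split; nra.
have [a Ha] : exists l : R, forall e : R, 0 < e ->
    exists N, forall n, (N <= n)%N -> `|Re (u n) - l| < e.
  apply: real_cauchy_cvg => e e0; have [N H] := cu _ (exprn_gt0 2 e0).
  exists N => m n mN nN; have := H _ _ mN nN; rewrite cformE /normsq !raddfB /=.
  by move=> /(sq _ _ _ e0)[].
have [b Hb] : exists l : R, forall e : R, 0 < e ->
    exists N, forall n, (N <= n)%N -> `|Im (u n) - l| < e.
  apply: real_cauchy_cvg => e e0; have [N H] := cu _ (exprn_gt0 2 e0).
  exists N => m n mN nN; have := H _ _ mN nN; rewrite cformE /normsq !raddfB /=.
  by move=> /(sq _ _ _ e0)[].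
exists (Complex a b) => e e0.
pose d := Num.min 1 (e / 2).
have d0 : 0 < d by rewrite lt_min ltr01 divr_gt0.
have [N1 H1] := Ha _ d0; have [N2 H2] := Hb _ d0.
exists (maxn N1 N2) => n; rewrite geq_max => /andP[/H1 h1 /H2 h2].
rewrite cformE /normsq !raddfB /=.
have lt2 (x : R) : `|x| < d -> x ^+ 2 < e / 2.
  rewrite lt_min => /andP[x1 x2]; rewrite -real_normK ?num_real//.
  by have := normr_ge0 x; nra.
by have := lt2 _ h1; have := lt2 _ h2; lra.
Qed.

End Forms.

Section Estimates.
Variables (R : realType) (E : lmodType R[i]) (s : form E).

Lemma fq_triangle x y :
  Num.sqrt (fq s (x + y)) <= Num.sqrt (fq s x) + Num.sqrt (fq s y).
Proof.
rewrite -(ler_pXn2r (n := 2))// ?nnegrE ?addr_ge0 ?sqrtr_ge0//.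
rewrite sqrrD !sqr_sqrtr ?fq_ge0// fqD.
have : Re (s x y) <= Num.sqrt (fq s x) * Num.sqrt (fq s y).
  apply: le_trans (ler_norm _) _.
  rewrite -(ler_pXn2r (n := 2))// ?nnegrE ?mulr_ge0 ?sqrtr_ge0//.
  rewrite exprMn !sqr_sqrtr ?fq_ge0// real_normK ?num_real//.
  by apply: le_trans (fCS _ _ _); rewrite lerDl sqr_ge0.
by set a := Num.sqrt _ * _; rewrite mulr2n; lra.
Qed.

Lemma fcvg0_bounded u v (M : R) : fcvg s u 0 -> (forall n, fq s (v n) <= M) ->
  fcvg (cform R) (fun n => s (u n) (v n)) 0.
Proof.
move=> u0 vM e e0; have M0 : 0 <= M := le_trans (fq_ge0 s _) (vM 0%N).
have d0 : 0 < e / (M + 1) by rewrite divr_gt0// ltr_wpDl.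
have [N H] := u0 _ d0; exists N => n /H; rewrite !subr0 cformE.
rewrite ltr_pdivlMr ?ltr_wpDl// => h; apply: le_lt_trans (fCS _ _ _) _.
by have := vM n; have := fq_ge0 s (u n); nra.
Qed.

Lemma fcauchy_fs u v : fcauchy s u -> fcauchy s v ->
  fcauchy (cform R) (fun n => s (u n) (v n)).
Proof.
move=> cu cv; have [M [M0 uM]] := fcauchy_bounded cu.
have [M' [M'0 vM]] := fcauchy_bounded cv.
move=> e e0; have e4 := div4_gt0 e0.
have [N1 H1] := cu _ (divr_gt0 e4 M'0); have [N2 H2] := cv _ (divr_gt0 e4 M0).
exists (maxn N1 N2) => m n; rewrite !geq_max => /andP[m1 m2] /andP[n1 n2].
have -> : s (u m) (v m) - s (u n) (v n) = s (u m - u n) (v m) + s (u n) (v m - v n).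
  by rewrite fsBl fsBr subrKA.
apply: le_lt_trans (fqD_le _ _ _) _; rewrite !cformE.
have := fCS s (u m - u n) (v m); have := fCS s (u n) (v m - v n).
have := H1 _ _ m1 n1; have := H2 _ _ m2 n2; rewrite !ltr_pdivlMr//.
have := uM n; have := vM m.
have := fq_ge0 s (u m - u n); have := fq_ge0 s (v m - v n); nra.
Qed.

(** Split [fq s (w n)] as the real part of [s (w n - w m) (w n)] plus that of [s (w m) (w n)]. For
    [n] large the first is small uniformly in large [m]; for that fixed [n], the second tends to 0
    in [m]. *)
Lemma weak_null_cauchy w : fcauchy s w ->
  (forall y, fcvg (cform R) (fun n => s (w n) y) 0) -> fcvg s w 0.
Proof.
move=> cw w0; have [M [M0 wM]] := fcauchy_bounded cw.
move=> e e0; have e2 : 0 < (e / 2) ^+ 2 by rewrite exprn_gt0// divr_gt0.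
have [N H] := cw _ (divr_gt0 e2 M0); exists N => n Nn; rewrite subr0.
have [N' H'] := w0 (w n) _ e2.
have := H _ _ Nn (leq_maxl N N'); have := H' _ (leq_maxr N N').
set m := maxn N N'; rewrite subr0 cformE ltr_pdivlMr// => h1 h2.
have h3 : normsq (s (w n - w m) (w n)) < (e / 2) ^+ 2.
  apply: le_lt_trans (fCS _ _ _) _; apply: le_lt_trans h2.
  by rewrite ler_wpM2l ?fq_ge0.
have -> : fq s (w n) = Re (s (w n - w m) (w n)) + Re (s (w m) (w n)).
  by rewrite -raddfD -fsDl subrK.
have aux (z : R[i]) : normsq z < (e / 2) ^+ 2 -> Re z < e / 2.
  by rewrite /normsq => h; have := sqr_ge0 (Im z); nra.
by have := aux _ h1; have := aux _ h3; lra.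
Qed.

Lemma ccvg_Re_le (u : nat -> R[i]) (x : R[i]) (a : R) N : fcvg (cform R) u x ->
  (forall n, (N <= n)%N -> Re (u n) <= a) -> Re x <= a.
Proof.
move=> ux ua; rewrite leNgt; apply/negP => ax.
have p : 0 < (Re x - a) ^+ 2 by rewrite exprn_gt0// subr_gt0.
have [N' /(_ _ (leq_maxl N' N))] := ux _ p; rewrite cformE /normsq !raddfB /=.
have := ua _ (leq_maxr N' N); have := sqr_ge0 (Im (u (maxn N' N)) - Im x); nra.
Qed.

End Estimates.

(** * Projections and approximation by orbits *)

Section Projection.
Variable R : realType.
Variables (E : lmodType R[i]) (s : form E).

Definition fcomplete := forall u, fcauchy s u -> exists l, fcvg s u l.

Lemma fcvg_fq (u : nat -> E) x : fcvg s u x -> forall e : R, 0 < e ->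
  exists N, forall n, (N <= n)%N -> `|fq s (u n) - fq s x| < e.
Proof.
move=> ux e e0; have [N H] := fcvg_fs ux ux (exprn_gt0 2 e0).
exists N => n /H; rewrite !fs_diag cformE -rmorphB normsq_real => h.
by rewrite ltr_norml; apply/andP; split; nra.
Qed.

Lemma fcvg_fq_ge (u : nat -> E) x (a : R) :
  fcvg s u x -> (forall n, a <= fq s (u n)) -> a <= fq s x.
Proof. by move=> ux; apply: ccvg_Re; exact: fcvg_fs. Qed.

Lemma fcvg_fq_le (u : nat -> E) x (a : R) : fcvg s u x ->
  (forall e : R, 0 < e -> exists N, forall n, (N <= n)%N -> fq s (u n) < a + e) ->
  fq s x <= a.
Proof.
move=> ux ua; rewrite leNgt; apply/negP => ax.
have p : 0 < (fq s x - a) / 2 by rewrite divr_gt0 ?subr_gt0.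
have [N1 H1] := fcvg_fq ux p; have [N2 H2] := ua _ p.
have := H1 _ (leq_maxl N1 N2); have := H2 _ (leq_maxr N1 N2).
rewrite ltr_norml => ? /andP[? ?]; lra.
Qed.

Hypothesis scomplete : fcomplete.

(** A minimizing sequence for the distance from [e] to [X] is Cauchy by the parallelogram law, since
    midpoints stay in [X]. Only real scalars act on [X], because the self-adjoint part of an orbit
    is one of its instances; [X] is not closed, so [p] is only a limit of its elements. *)
Lemma real_projection (X : E -> Prop) e : X 0 ->
  (forall x y, X x -> X y -> X (x + y)) ->
  (forall (a : R) x, X x -> X (a%:C%C *: x)) ->
  exists p, (exists u, (forall n, X (u n)) /\ fcvg s u p) /\
    forall x, X x -> Re (s (e - p) x) = 0.
Proof.
move=> X0 XD XZ.
pose D := [set fq s (e - x) | x in X].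
have D0 : has_inf D.
  split; first by exists (fq s (e - 0)), 0.
  by exists 0 => _ [x _ <-]; exact: fq_ge0.
pose d := inf D.
have dle x : X x -> d <= fq s (e - x).
  by move=> Xx; apply: ge_inf; [case: D0|exists x].
have /choice[u Hu] : forall n : nat, exists x, X x /\ fq s (e - x) < d + n.+1%:R^-1.
  move=> n; have [] := @inf_adherent _ D n.+1%:R^-1 _ D0; first by rewrite invr_gt0.
  by move=> _ [x Xx <-] h; exists x.
have cu : fcauchy s u.
  move=> e1 e10; have [N H] := natSinv_lt (div4_gt0 e10).
  exists N => m n /H hm /H hn.
  have := fq_parallelogram s (e - u n) (e - u m).
  have -> : e - u n - (e - u m) = u m - u n by rewrite opprB addrC subrKA.
  have -> : e - u n + (e - u m) = 2%:C%C *: (e - 2^-1%:C%C *: (u n + u m)).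
    rewrite scalerBr scalerA -rmorphM mulfV ?pnatr_eq0// scale1r.
    have -> : 2%:C%C *: e = e + e.
      by rewrite -[in RHS](scale1r e) -scalerDl -rmorphD.
    by rewrite opprD addrACA.
  rewrite fqZ normsq_real (_ : 2 ^+ 2 = 4); last by ring.
  have := dle _ (XZ 2^-1 _ (XD _ _ (Hu n).1 (Hu m).1)).
  have := (Hu n).2; have := (Hu m).2.
  move: (m.+1%:R^-1) (n.+1%:R^-1) hm hn => a b; lra.
have [p up] := scomplete cu.
have eup := fcvgB (fcvg_cst s e) up.
have pd : fq s (e - p) <= d.
  apply: (fcvg_fq_le eup) => e1 /natSinv_lt[N H]; exists N => n /H h.
  by have := (Hu n).2; move: (n.+1%:R^-1) h => a; lra.
exists p; split; first by exists u; split=> // n; exact: (Hu n).1.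
move=> x Xx.
have key (a : R) : 2 * a * Re (s (e - p) x) <= a ^+ 2 * fq s x.
  have : d <= fq s (e - p - a%:C%C *: x).
    apply: (fcvg_fq_ge (fcvgB eup (fcvg_cst s (a%:C%C *: x)))) => n.
    by rewrite -addrA -opprD; apply/dle/XD; [exact: (Hu n).1|exact: XZ].
  rewrite fqBE fsZr fqZ normsq_real cReM cReC cImC /= oppr0 mul0r subr0; lra.
set c := Re _ in key *; set b := fq s x in key.
have b0 : 0 <= b := fq_ge0 s x.
(* With [a = c / (b + 1)], so [c = (b + 1) a], [key] reads [2 (b + 1) a^2 <= b a^2] and forces
   [a = 0]. The 1 keeps the denominator positive when [x] is null. *)
have := key (c / (b + 1)).
have -> : 2 * (c / (b + 1)) * c = (2 * (b + 1)) * (c / (b + 1)) ^+ 2.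
  by field; lra.
have := sqr_ge0 (c / (b + 1)); set y := (c / (b + 1)) => y0 h.
have : y ^+ 2 = 0 by nra.
move/eqP; rewrite sqrf_eq0 mulf_eq0 invr_eq0 => /orP[/eqP//|/eqP]; lra.
Qed.

Lemma fs_orthC x y : s x y = 0 -> s y x = 0.
Proof. by move=> xy; rewrite fsC xy rmorph0. Qed.

Lemma complex_projection (X : E -> Prop) e : X 0 ->
  (forall k x y, X x -> X y -> X (k *: x + y)) ->
  exists p, (exists u, (forall n, X (u n)) /\ fcvg s u p) /\
    forall x, X x -> s (e - p) x = 0.
Proof.
move=> X0 XP.
have [||p [up Hp]] := @real_projection X e X0.
- by move=> x y Xx Xy; rewrite -(scale1r x); exact: XP.
- by move=> a x Xx; rewrite -[_ *: x]addr0; exact: XP.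
exists p; split=> // x Xx; apply: complexP; first exact: Hp.
(* The form is conjugate-linear in its second argument, so the real part at [i x] is the imaginary
   part at [x]. *)
have /Hp : X ('i%C *: x) by rewrite -[_ *: x]addr0; exact: XP.
by rewrite fsZr cReM cReC cImC /= mul0r mulN1r sub0r opprK.
Qed.

Lemma fcvg_orth u x y : fcvg s u x -> (forall n, s (u n) y = 0) -> s x y = 0.
Proof.
move=> /(@fcvg_fsl _ _ s u x y) ux uy; apply: ccvg_unique ux _.
by under eq_fun do rewrite uy; exact: fcvg_cst.
Qed.

End Projection.

(** * Modules over the algebra and dominated vectors *)

Section Modules.
Variables (R : realType) (B : cstarAlgType R).

(** Algebraic *-representations on semi-inner product spaces: a direct sum is then just a product
    type with the componentwise action. *)
Record action (E : lmodType R[i]) (s : form E) := Action {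
  act :> B -> E -> E;
  actP : forall b k x y, act b (k *: x + y) = k *: act b x + act b y;
  actPl : forall k a b x, act (k *: a + b) x = k *: act a x + act b x;
  act1 : forall x, act 1 x = x;
  actM : forall a b x, act (a * b) x = act a (act b x);
  act_adj : forall b x y, s (act b x) y = s x (act (star b) y) }.

Variable psi : B -> R[i].

Section Single.
Variables (E : lmodType R[i]) (s : form E) (A : action s).

Lemma actD b x y : A b (x + y) = A b x + A b y.
Proof. by have := actP A b 1 x y; rewrite !scale1r. Qed.
Lemma act0 b : A b 0 = 0.
Proof. by apply: (addrI (A b 0)); rewrite -actD !addr0. Qed.
Lemma actDl a b x : A (a + b) x = A a x + A b x.
Proof. by have := actPl A 1 a b x; rewrite !scale1r. Qed.
Lemma act0l x : A 0 x = 0.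
Proof. by apply: (addrI (A 0 x)); rewrite -actDl !addr0. Qed.
Lemma actZl k b x : A (k *: b) x = k *: A b x.
Proof. by rewrite -[k *: b]addr0 actPl act0l addr0. Qed.
Lemma act_adj' b x y : s x (A b y) = s (A (star b) x) y.
Proof. by rewrite act_adj starK. Qed.

Definition dominated z := exists C : R, 0 <= C /\
  forall b, fq s (A b z) <= C * Re (psi (star b * b)).

(** Whole orbits occur because [A b z] need not be dominated when [z] is. Bounded operators
    commuting with the action preserve [dominated], so on a Hilbert space the projection onto this
    subspace lies in the double commutant; [orbit_approx] is this fact at a single vector. *)
Definition orth_dominated y := forall z b, dominated z -> s y (A b z) = 0.

Lemma orth_dominatedP k x y : orth_dominated x -> orth_dominated y -> orth_dominated (k *: x + y).
Proof. by move=> hx hy z b hz; rewrite fsP hx// hy// mulr0 addr0. Qed.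

Lemma orth_dominated0 : orth_dominated 0.
Proof. by move=> z b _; rewrite fs0l. Qed.

Hypothesis sc : fcomplete s.

Lemma orth_dominated_split e : exists p, orth_dominated p /\
  forall y, orth_dominated y -> s (e - p) y = 0.
Proof.
have [p [[u [Xu up]] Hp]] := complex_projection sc e orth_dominated0 orth_dominatedP.
exists p; split=> // z b hz; apply: (fcvg_orth up) => n; exact: Xu.
Qed.

Let orbit w x := exists b, x = A b w.

Let orbit_split w e : exists q, (exists b : nat -> B, fcvg s (fun n => A (b n) w) q) /\
  forall b, s (e - q) (A b w) = 0.
Proof.
have [||q [[u [Xu uq]] Hq]] := @complex_projection _ _ _ sc (orbit w) e.
- by exists 0; rewrite act0l.
- by move=> k _ _ [a ->] [b ->]; exists (k *: a + b); rewrite actPl.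
have [b Hb] := choice Xu; exists q; split; last by move=> a; apply: Hq; exists a.
by exists b; rewrite (_ : (fun n => _) = u)//; apply/funext => n.
Qed.

Let orbit_orth w t q (b : nat -> B) c : fcvg s (fun n => A (b n) w) q ->
  (forall b, s t (A b w) = 0) -> s t (A c q) = 0.
Proof.
move=> bq tw; rewrite act_adj'; apply: fs_orthC; apply: (fcvg_orth bq) => n.
by apply: fs_orthC; rewrite -act_adj' -actM.
Qed.

(* The double commutant step: with q the projection of t onto the closure of the
   orbit of w, projecting dominated vectors along the same closure shows that
   t - q is again orthogonal to all dominated orbits, hence to t, w and q. *)
Lemma orbit_approx w t : orth_dominated t ->
  (forall y, orth_dominated y -> s (w - t) y = 0) ->
  forall e : R, 0 < e -> exists b, fq s (A b w - t) < e.
Proof.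
move=> ut wt.
have [q [[b bq] tq]] := orbit_split w t.
have tq0 c : s (t - q) (A c q) = 0 by apply: orbit_orth bq tq.
have ut' : orth_dominated (t - q).
  move=> z c hz; have [r [[d dr] zr]] := orbit_split w z.
  have zr0 a : s (z - r) (A a r) = 0 by apply: orbit_orth dr zr.
  have hz' : dominated (z - r).
    (* [A a z] is the orthogonal sum of [A a (z - r)] and [A a r], so the constant of [z] also
       serves for [z - r]. *)
    case: hz => C [C0 HC]; exists C; split=> // a; apply: le_trans (HC a).
    have -> : A a z = A a (z - r) + A a r by rewrite -actD subrK.
    by rewrite fqD act_adj -actM zr0 /= mulr0 addr0 lerDl fq_ge0.
  (* The part along [r] vanishes since [t - q] is orthogonal to the orbit of [w]. Against
     [A c (z - r)], [t] vanishes because [z - r] is dominated, and [q] because [z - r] is orthogonal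
     to that orbit. *)
  rewrite -(subrK r z) actD fsDr (orbit_orth c dr tq) addr0 fsBl ut// sub0r.
  by rewrite fsC act_adj (orbit_orth _ bq zr) rmorph0 oppr0.
have t0 : fq s (t - q) = 0.
  have w0 : s (t - q) w = 0 by have := tq 1; rewrite act1.
  have q0 : s (t - q) q = 0 by have := tq0 1; rewrite act1.
  have t0 : s (t - q) t = 0.
    have /eqP := fs_orthC (wt _ ut').
    by rewrite fsBr w0 sub0r oppr_eq0 => /eqP.
  by rewrite /fq fsBr t0 q0 subrr.
move=> e e0; have [N /(_ _ (leqnn _)) H] := bq _ (div4_gt0 e0); exists (b N).
have := fqB_le s (A (b N) w) q t; rewrite (fqB s q) t0; lra.
Qed.

End Single.

Section Pair.
Variables (E1 E2 : lmodType R[i]) (s1 : form E1) (s2 : form E2).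
Variables (A1 : action s1) (A2 : action s2).

Definition pair_fs (x y : E1 * E2) := s1 x.1 y.1 + s2 x.2 y.2.

Let pair_fsP z k x y : pair_fs (k *: x + y) z = k * pair_fs x z + pair_fs y z.
Proof. by rewrite /pair_fs /= !fsP mulrDr addrACA. Qed.
Let pair_fsC x y : pair_fs y x = (pair_fs x y)^*.
Proof. by rewrite /pair_fs rmorphD /= -!fsC. Qed.
Let pair_fs_ge0 x : 0 <= Re (pair_fs x x).
Proof. by rewrite raddfD addr_ge0 ?fs_ge0. Qed.

Definition pair_form : form (E1 * E2)%type := Form pair_fsP pair_fsC pair_fs_ge0.

Lemma fq_pair x : fq pair_form x = fq s1 x.1 + fq s2 x.2.
Proof. by rewrite /fq raddfD. Qed.

Definition pair_act b (x : E1 * E2) := (A1 b x.1, A2 b x.2).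

Let pair_actP b k x y : pair_act b (k *: x + y) = k *: pair_act b x + pair_act b y.
Proof. by rewrite /pair_act /= !actP. Qed.
Let pair_actPl k a b x : pair_act (k *: a + b) x = k *: pair_act a x + pair_act b x.
Proof. by rewrite /pair_act /= !actPl. Qed.
Let pair_act1 x : pair_act 1 x = x.
Proof. by case: x => x y; rewrite /pair_act !act1. Qed.
Let pair_actM a b x : pair_act (a * b) x = pair_act a (pair_act b x).
Proof. by rewrite /pair_act !actM. Qed.
Let pair_act_adj b x y : pair_form (pair_act b x) y = pair_form x (pair_act (star b) y).
Proof. by rewrite /= /pair_fs /= !act_adj. Qed.

Definition pair_action : action pair_form :=
  Action pair_actP pair_actPl pair_act1 pair_actM pair_act_adj.

Lemma pair_complete : fcomplete s1 -> fcomplete s2 -> fcomplete pair_form.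
Proof.
move=> c1 c2 u cu.
have [x1 h1] : exists l, fcvg s1 (fun n => (u n).1) l.
  apply: c1 => e /cu[N H]; exists N => m n mN nN; apply: le_lt_trans (H m n mN nN).
  by rewrite fq_pair /= lerDl fq_ge0.
have [x2 h2] : exists l, fcvg s2 (fun n => (u n).2) l.
  apply: c2 => e /cu[N H]; exists N => m n mN nN; apply: le_lt_trans (H m n mN nN).
  by rewrite fq_pair /= lerDr fq_ge0.
exists (x1, x2) => e e0; have [N1 H1] := h1 _ (div4_gt0 e0).
have [N2 H2] := h2 _ (div4_gt0 e0); exists (maxn N1 N2) => n.
rewrite geq_max fq_pair /= => /andP[/H1 ? /H2 ?]; lra.
Qed.

(** Components of a dominated pair are dominated. Together with the two converses below, which pad
    by 0, this makes [orth_dominated] componentwise, so the approximation lemmas applied to a direct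
    sum treat several vectors with one element [b]. *)
Lemma orth_dominated_pair y1 y2 : orth_dominated A1 y1 -> orth_dominated A2 y2 ->
  orth_dominated pair_action (y1, y2).
Proof.
move=> u1 u2 [z1 z2] b [C [C0 HC]]; rewrite /= /pair_fs /= u1 ?u2 ?addr0//;
  exists C; split=> // a; apply: le_trans (HC a); rewrite fq_pair /=.
  by rewrite lerDr fq_ge0.
by rewrite lerDl fq_ge0.
Qed.

Lemma orth_dominated_pair1 y : orth_dominated pair_action y -> orth_dominated A1 y.1.
Proof.
move=> u z b [C [C0 HC]]; have := u (z, 0) b; rewrite /= /pair_fs /= act0 fs0r addr0.
by apply; exists C; split=> // a; rewrite fq_pair /= act0 fq0 addr0.
Qed.

Lemma orth_dominated_pair2 y : orth_dominated pair_action y -> orth_dominated A2 y.2.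
Proof.
move=> u z b [C [C0 HC]]; have := u (0, z) b; rewrite /= /pair_fs /= act0 fs0r add0r.
by apply; exists C; split=> // a; rewrite fq_pair /= act0 fq0 add0r.
Qed.

End Pair.

(** * Approximation by self-adjoint elements *)

Section SelfAdjoint.
Variables (E : lmodType R[i]) (s : form E) (A : action s).
Hypothesis sc : fcomplete s.

Lemma star0 : star (0 : B) = 0.
Proof. by apply: (addrI (star (0 : B))); rewrite -starD !addr0. Qed.

(* The residual r of the real projection of t satisfies <b w, r> + <b r, w> = 0 for
   all b, and [orbit_approx] for the pair (w, r) turns this into Re <t, r> = 0. *)
Lemma sa_orbit_approx w t : orth_dominated A t ->
  (forall y, orth_dominated A y -> s (w - t) y = 0) ->
  forall e : R, 0 < e -> exists b, star b = b /\ fq s (A b w - t) < e.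
Proof.
move=> ut wt.
have [|||p [[u [Xu up]] Hp]] :=
  @real_projection _ _ _ sc (fun x => exists b, star b = b /\ x = A b w) t.
- by exists 0; rewrite star0 act0l.
- move=> _ _ [a [sa ->]] [b [sb ->]]; exists (a + b).
  by rewrite starD sa sb actDl.
- move=> a _ [b [sb ->]]; exists (a%:C%C *: b); rewrite starZ sb actZl; split=> //.
  by congr (_ *: _); apply: complexP; rewrite ?cReC ?cImC /= ?oppr0.
set r := t - p in Hp.
have sH h : star h = h -> s (A h w) r + s (A h r) w = 0.
  move=> sh; have /Hp rh : exists b, star b = b /\ A h w = A b w by exists h.
  rewrite (act_adj A h r) sh (fsC s r).
  by apply: complexP; rewrite raddfD /= ?cReC ?cImC ?addNr// rh addr0.
(* The expression is complex linear in [b], so it suffices to split [b] into self-adjoint parts. *)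
have allH b : s (A b w) r + s (A b r) w = 0.
  pose h1 := b + star b; pose h2 := 'i%C *: (b - star b).
  have s1 : star h1 = h1 by rewrite /h1 starD starK addrC.
  have s2 : star h2 = h2.
    rewrite /h2 starZ -[- star b]scaleN1r starD starZ starK.
    have -> : (-1 : R[i])^* = -1 by rewrite rmorphN rmorph1.
    have -> : ('i%C : R[i])^* = - 'i%C by apply: complexP; rewrite ?cReC ?cImC /= ?oppr0.
    by rewrite !scaleN1r scaleNr -scalerN opprB.
  have hb : 2%:R *: b = h1 - 'i%C *: h2.
    have i2 : 'i%C * 'i%C = -1 :> R[i] by rewrite -expr2 sqr_i.
    by rewrite /h1 /h2 scalerA i2 scaleN1r opprK addrACA subrr addr0 -mulr2n scaler_nat.
  pose T c := s (A c w) r + s (A c r) w.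
  have TP k a c : T (k *: a + c) = k * T a + T c.
    by rewrite /T !actPl !fsP mulrDr addrACA.
  have T0 : T 0 = 0 by rewrite /T !act0l !fs0l addr0.
  have : 2%:R * T b = 0.
    rewrite -[_ * _]addr0 -[X in _ + X]T0 -TP addr0 hb addrC -scaleNr TP.
    by rewrite /T !sH// mulr0 addr0.
  by move/eqP; rewrite mulf_eq0 pnatr_eq0 => /eqP.
have [rF [urF rrF]] := orth_dominated_split A sc r.
have /choice[bb Hbb] : forall n : nat, exists b,
    fq (pair_form s s) (pair_action A A b (w, r) - (t, rF)) < n.+1%:R^-1.
  move=> n; apply: orbit_approx.
  - exact: pair_complete.
  - exact: orth_dominated_pair.
  - move=> y uy; rewrite /= /pair_fs /= wt ?rrF ?addr0//.
      exact: orth_dominated_pair2 uy.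
    exact: orth_dominated_pair1 uy.
  - by rewrite invr_gt0.
have cw : fcvg s (fun n => A (bb n) w) t.
  apply: (fcvg_of_le (@natSinv_lt R)) => n; apply: le_trans (ltW (Hbb n)).
  by rewrite fq_pair /= lerDl fq_ge0.
have cr : fcvg s (fun n => A (bb n) r) rF.
  apply: (fcvg_of_le (@natSinv_lt R)) => n; apply: le_trans (ltW (Hbb n)).
  by rewrite fq_pair /= lerDr fq_ge0.
have E0 : s t r + s rF w = 0.
  apply: ccvg_unique (fcvgD (fcvg_fsl r cw) (fcvg_fsl w cr)) _.
  by under eq_fun do rewrite allH; exact: fcvg_cst.
(* [w - t] is orthogonal to [rF], and [r - rF] to [t]; hence [s rF w = s rF t = s r t], and [E0]
   says that twice this real part is 0. *)
have trE : Re (s t r) = 0.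
  have h1 : s rF w = s rF t.
    by rewrite -(subrK t w) fsDr (fs_orthC (wt _ urF)) add0r.
  have h2 : s r t = s rF t by rewrite -{1}(subrK rF r) fsDl rrF// add0r.
  have := congr1 (@complex.Re R) E0; rewrite raddfD /= h1 -h2 (fsC s t r) cReC; lra.
have r0 : fq s r = 0.
  have pr : Re (s p r) = 0.
    apply/le_anti/andP; split.
      rewrite -oppr_ge0 -raddfN /= -fsNl.
      apply: (ccvg_Re (fcvg_fsl r (fcvgN up))) => n.
      by rewrite fsNl raddfN /= fsC cReC Hp ?oppr0//; exact: Xu.
    apply: (ccvg_Re (fcvg_fsl r up)) => n.
    by rewrite fsC cReC Hp//; exact: Xu.
  by rewrite /fq {1}/r fsBl raddfB /= trE pr subr0.
move=> e e0; have [N /(_ _ (leqnn _)) H] := up _ (div4_gt0 e0).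
have [b [sb ub]] := Xu N; exists b; split=> //; rewrite -ub.
have := fqB_le s (u N) p t; rewrite (fqB s p) -/r r0; lra.
Qed.

End SelfAdjoint.

End Modules.

(** * Completions *)

Section Completion.
Variables (R : realType) (E : lmodType R[i]) (s : form E).
Implicit Types (u v : nat -> E) (x y : E).

(** Cauchy sequences differing by a null sequence have the same limit functional, so recording the
    functional replaces a quotient of sequences. *)
Definition represented_by u (f : E -> R[i]) :=
  fcauchy s u /\ forall y, fcvg (cform R) (fun n => s (u n) y) (f y).

(* The vectors of the completion are the functionals <x, .> with x in it. *)
Record completion := Completion {
  completion_fun :> E -> R[i];
  completionP : exists u, represented_by u completion_fun }.
Implicit Types f g h : completion.

HB.instance Definition _ := gen_eqMixin completion.
HB.instance Definition _ := gen_choiceMixin completion.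

Lemma completion_eq f g : f =1 g -> f = g.
Proof.
case: f g => [f fP] [g gP] /= /funext fg; case: _ / fg in gP *.
by congr Completion; exact: Prop_irrelevance.
Qed.

Lemma fcauchy_cst x : fcauchy s (fun=> x).
Proof. exact: fcvg_cauchy (fcvg_cst s x). Qed.

Lemma fcauchyZ k u : fcauchy s u -> fcauchy s (fun n => k *: u n).
Proof.
by apply: (@fcauchy_map _ _ s _ s ( *:%R k) (normsq k)) => [x y|x];
  rewrite ?scalerBr ?fqZ.
Qed.

Lemma represented_cst x : represented_by (fun=> x) (s x).
Proof. by split=> [|y]; [exact: fcauchy_cst|exact: (@fcvg_cst _ _ (cform R))]. Qed.

Lemma represented_lin k u v (f g : E -> R[i]) : represented_by u f ->
  represented_by v g -> represented_by (fun n => k *: u n + v n) (fun y => k * f y + g y).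
Proof.
move=> [cu uf] [cv vg]; split; first by apply: fcauchyD => //; exact: fcauchyZ.
move=> y; have := @fcvgP _ _ (cform R) k _ _ _ _ (uf y) (vg y).
by under [in X in _ -> X]eq_fun do rewrite fsP.
Qed.

Let lin_subproof (k : R[i]) f g : exists u, represented_by u (fun y => k * f y + g y).
Proof.
by have [[u uf] [v vg]] := (completionP f, completionP g);
  exists (fun n => k *: u n + v n); exact: represented_lin.
Qed.

Definition to_completion x := 
  Completion (@ex_intro _ (fun u => represented_by u (s x)) _ (represented_cst x)).

Let clin (k : R[i]) f g := Completion (lin_subproof k f g).
Let czero := to_completion 0.
Let cadd f g := clin 1 f g.
Let cscale (k : R[i]) f := clin k f czero.
Let copp f := cscale (-1) f.

Let caddE f g y : cadd f g y = f y + g y. Proof. by rewrite /= mul1r. Qed.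
Let cscaleE k f y : cscale k f y = k * f y. Proof. by rewrite /= fs0l addr0. Qed.

Let addA : associative cadd.
Proof. by move=> f g h; apply: completion_eq => x; rewrite !caddE addrA. Qed.
Let addC : commutative cadd.
Proof. by move=> f g; apply: completion_eq => x; rewrite !caddE addrC. Qed.
Let add0 : left_id czero cadd.
Proof. by move=> f; apply: completion_eq => x; rewrite caddE /= fs0l add0r. Qed.
Let addN : left_inverse czero copp cadd.
Proof.
by move=> f; apply: completion_eq => x; rewrite caddE cscaleE /= fs0l mulN1r addNr.
Qed.

HB.instance Definition _ := GRing.isZmodule.Build completion addA addC add0 addN.

Let scaleA k l f : cscale k (cscale l f) = cscale (k * l) f.
Proof. by apply: completion_eq => x; rewrite !cscaleE mulrA. Qed.
Let scale1 : left_id 1 cscale.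
Proof. by move=> f; apply: completion_eq => x; rewrite cscaleE mul1r. Qed.
Let scaleDr : right_distributive cscale +%R.
Proof.
move=> k f g; apply: completion_eq => x.
transitivity (k * cadd f g x); first exact: cscaleE.
by rewrite caddE mulrDr [RHS]caddE !cscaleE.
Qed.
Let scaleDl f : {morph cscale^~ f : a b / a + b}.
Proof.
move=> k l; apply: completion_eq => x.
by rewrite cscaleE [RHS]caddE !cscaleE mulrDl.
Qed.

HB.instance Definition _ :=
  GRing.Zmodule_isLmodule.Build R[i] completion scaleA scale1 scaleDr scaleDl.

Lemma completionDE f g y : (f + g) y = f y + g y. Proof. exact: caddE. Qed.
Lemma completionZE k f y : (k *: f) y = k * f y. Proof. exact: cscaleE. Qed.
Lemma completionBE f g y : (f - g) y = f y - g y.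
Proof. by rewrite completionDE -scaleN1r completionZE mulN1r. Qed.

Lemma to_completionP k x y :
  to_completion (k *: x + y) = k *: to_completion x + to_completion y.
Proof.
by apply: completion_eq => z; rewrite completionDE completionZE /= fsP.
Qed.

Lemma to_completionB x y : to_completion (x - y) = to_completion x - to_completion y.
Proof.
by apply: completion_eq => z; rewrite completionBE /= fsBl.
Qed.

Let repr f := sval (cid (completionP f)).
Let reprP f : represented_by (repr f) f := svalP (cid (completionP f)).

Let cinner_subproof f g :
  exists l, fcvg (cform R) (fun n => s (repr f n) (repr g n)) l.
Proof. by apply: ccomplete; apply: fcauchy_fs; exact: (reprP _).1. Qed.

Definition cinner f g : R[i] := sval (cid (cinner_subproof f g)).

Let represented_unique u v f : represented_by u f -> represented_by v f ->
  fcvg s (fun n => u n - v n) 0.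
Proof.
move=> [cu uf] [cv vf]; apply: weak_null_cauchy.
  apply: fcauchyD => //; have := fcauchyZ (-1) cv.
  by under eq_fun do rewrite scaleN1r.
move=> y; have := @fcvgB _ _ (cform R) _ _ _ _ (uf y) (vf y); rewrite subrr.
by under eq_fun do rewrite -fsBl.
Qed.

(** Independence of the chosen sequences: changing one argument at a time alters the scalars by a
    product of a null sequence with a bounded one. The conjugate in [h2] brings the null sequence of
    the second argument into the first slot of [fcvg0_bounded]. *)
Lemma cinner_cvg u v f g : represented_by u f -> represented_by v g ->
  fcvg (cform R) (fun n => s (u n) (v n)) (cinner f g).
Proof.
move=> uf vg; have := svalP (cid (cinner_subproof f g)).
rewrite -/(cinner f g) => H.
have [M [_ vM]] := fcauchy_bounded vg.1.
have [M' [_ uM]] := fcauchy_bounded (reprP f).1.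
have h1 := fcvg0_bounded (represented_unique uf (reprP f)) vM.
have h2 := ccvg_conj (fcvg0_bounded (represented_unique vg (reprP g)) uM).
have := @fcvgD _ _ (cform R) _ _ _ _ (@fcvgD _ _ (cform R) _ _ _ _ h1 h2) H.
rewrite rmorph0 !add0r; congr (fcvg _ _ _); apply/funext => n.
by rewrite -fsC fsBl fsBr -addrA subrK subrK.
Qed.

Let cinnerP h k f g : cinner (k *: f + g) h = k * cinner f h + cinner g h.
Proof.
apply: ccvg_unique (@fcvgP _ _ (cform R) k _ _ _ _
  (cinner_cvg (reprP f) (reprP h)) (cinner_cvg (reprP g) (reprP h))).
under eq_fun do rewrite -fsP; apply: cinner_cvg => //.
have := represented_lin k (reprP f) (reprP g); congr represented_by.
by apply/funext => y; rewrite completionDE completionZE.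
Qed.

Let cinnerC f g : cinner g f = (cinner f g)^*.
Proof.
apply: ccvg_unique (ccvg_conj (cinner_cvg (reprP f) (reprP g))).
by under eq_fun do rewrite -fsC; exact: cinner_cvg.
Qed.

Let cinner_ge0 f : 0 <= Re (cinner f f).
Proof. by apply: (ccvg_Re (cinner_cvg (reprP f) (reprP f))) => n; exact: fs_ge0. Qed.

Definition completion_form : form completion := Form cinnerP cinnerC cinner_ge0.

Lemma cinnerE f x : cinner f (to_completion x) = f x.
Proof.
apply: (ccvg_unique (@cinner_cvg _ _ f (to_completion x) (reprP f) (represented_cst x))).
exact: (reprP f).2.
Qed.

Lemma completion_antilinear f k x y : f (k *: x + y) = k^* * f x + f y.
Proof.
rewrite -!cinnerE to_completionP -[cinner]/(fs completion_form).
by rewrite fsDr fsZr.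
Qed.

Let cinner_def f : fq completion_form f = 0 -> f = 0.
Proof.
move=> f0; apply: completion_eq => y; rewrite -cinnerE.
by rewrite [LHS](@fs_null _ _ completion_form)//= fs0l.
Qed.

Lemma fq_to_completion x : fq completion_form (to_completion x) = fq s x.
Proof. by rewrite /fq /= cinnerE. Qed.

(** The vector [f - to_completion (u n)] is represented by the sequence of [u m - u n] in [m], so
    the Cauchy bound passes to the limit in [m]. *)
Lemma to_completion_cvg u f : represented_by u f ->
  fcvg completion_form (fun n => to_completion (u n)) f.
Proof.
move=> uf e e0; have [N H] := uf.1 _ (div4_gt0 e0).
exists N => n Nn; rewrite fqB.
apply: (@le_lt_trans _ _ (e / 4)); last by lra.
have rf : represented_by (fun m => u m - u n) (f - to_completion (u n)).
  have := represented_lin (-1) (represented_cst (u n)) uf.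
  rewrite (_ : (fun y => _) = (f - to_completion (u n) : E -> R[i])).
    by congr represented_by; apply/funext => m; rewrite scaleN1r addrC.
  by apply/funext => y; rewrite completionBE mulN1r addrC.
apply: (ccvg_Re_le (N := N) (cinner_cvg rf rf)) => m Nm.
exact: ltW (H _ _ Nm Nn).
Qed.

(** Choose [x n] in [E] within squared distance [1 / (n + 1)] of [f n]; these form a Cauchy
    sequence, and the functional it defines is the limit. *)
Lemma completion_complete : fcomplete completion_form.
Proof.
move=> f cf.
have /choice[x Hx] : forall n : nat, exists x,
    fq completion_form (f n - to_completion x) < n.+1%:R^-1.
  move=> n; have p : 0 < n.+1%:R^-1 :> R by rewrite invr_gt0.
  have [N /(_ _ (leqnn _)) H] := to_completion_cvg (reprP (f n)) p.
  by exists (repr (f n) N); rewrite fqB.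
have cx : fcauchy s x.
  move=> e e0; have e4 := div4_gt0 (div4_gt0 e0).
  have [N1 H1] := cf _ e4; have [N2 H2] := natSinv_lt e4.
  exists (maxn N1 N2) => m n; rewrite !geq_max => /andP[m1 m2] /andP[n1 n2].
  rewrite -fq_to_completion to_completionB.
  have := fqB_le completion_form (to_completion (x m)) (f m) (to_completion (x n)).
  have := fqB_le completion_form (f m) (f n) (to_completion (x n)).
  have := H1 _ _ m1 n1; have := Hx m; have := Hx n; have := H2 _ m2; have := H2 _ n2.
  rewrite (fqB _ _ (f m)).
  move: (m.+1%:R^-1) (n.+1%:R^-1) => a b; lra.
have /choice[g Hg] : forall y, exists l, fcvg (cform R) (fun n => s (x n) y) l.
  by move=> y; apply: ccomplete; apply: fcauchy_fs => //; exact: fcauchy_cst.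
have xg : represented_by x g by [].
pose G := Completion (@ex_intro _ (fun u => represented_by u g) _ xg).
exists G => e e0; have e4 := div4_gt0 e0.
have [N1 H1] := to_completion_cvg (xg : represented_by x G) e4.
have [N2 H2] := natSinv_lt e4.
exists (maxn N1 N2) => n; rewrite geq_max => /andP[/H1 h1 /H2 h2].
have := fqB_le completion_form (f n) (to_completion (x n)) G.
by have := Hx n; move: (n.+1%:R^-1) h2 => a; lra.
Qed.

Let cnorm f : R[i] := (Num.sqrt (fq completion_form f))%:C%C.

Let cnormD f g : cnorm (f + g) <= cnorm f + cnorm g.
Proof. by rewrite -rmorphD lecR fq_triangle. Qed.

Let cnormZ k f : cnorm (k *: f) = `|k| * cnorm f.
Proof.
rewrite normc_def -rmorphM; congr _%:C%C.
by rewrite fqZ sqrtrM ?normsq_ge0.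
Qed.

Let cnorm0 f : cnorm f = 0 -> f = 0.
Proof.
move=> /complexI /eqP; rewrite sqrtr_eq0 => h; apply: cinner_def.
by apply/le_anti; rewrite h fq_ge0.
Qed.

HB.instance Definition _ := Lmodule_isNormed.Build R[i] completion cnormD cnormZ cnorm0.

Let cnormE f : `|f| = (Num.sqrt (fq completion_form f))%:C%C. Proof. by []. Qed.

Let ball_fq f g (e : R) : 0 < e -> ball f e%:C%C g <-> fq completion_form (f - g) < e ^+ 2.
Proof.
move=> e0; rewrite -ball_normE /ball_ /= cnormE ltcR.
by rewrite -[in X in X <-> _](gtr0_norm e0) -sqrtr_sqr ltr_sqrt ?exprn_gt0.
Qed.

(** Pick one ball of radius [1 / (n + 1)] in the filter for each [n]. Any two of them meet, so the
    centres form a Cauchy sequence, whose limit is the limit of the filter. *)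
Let complete_subproof (F : set_system completion) : ProperFilter F -> cauchy F -> cvg F.
Proof.
move=> FF /cauchyP Fc.
have /choice[f Hf] : forall n : nat, exists f, F (ball f (n.+1%:R^-1)%:C%C).
  by move=> n; apply: Fc; rewrite ltcR invr_gt0.
have dist m n (e : R) : m.+1%:R^-1 < e -> n.+1%:R^-1 < e ->
    fq completion_form (f m - f n) < 4 * e ^+ 2.
  move=> me ne; have [h [h1 h2]] := filter_ex (filterI (Hf m) (Hf n)).
  move: h1 h2; rewrite !ball_fq ?invr_gt0// => h1 h2.
  have := fqB_le completion_form (f m) h (f n); rewrite (fqB _ h).
  have p (k : nat) : 0 < k.+1%:R^-1 :> R by rewrite invr_gt0.
  move: (p m) (p n).
  move: h1 h2 me ne; move: (m.+1%:R^-1) (n.+1%:R^-1) => a b; nra.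
have cf : fcauchy completion_form f.
  (* The bound 1 gives [d^2 <= d], hence [4 d^2 <= e]. *)
  move=> e e0; pose d := Num.min 1 (e / 4).
  have d0 : 0 < d by rewrite lt_min ltr01 div4_gt0.
  have [N H] := natSinv_lt d0; exists N => m n /H hm /H hn.
  apply: lt_le_trans (dist _ _ _ hm hn) _.
  have : d <= 1 /\ d <= e / 4 by rewrite !ge_min !lexx orbT.
  by clear H hm hn; move: d d0 => a; nra.
have [l fl] := completion_complete cf.
apply/cvg_ex; exists l; apply/cvg_ballP => e e0.
have [r r0 ->] : exists2 r : R, 0 < r & e = r%:C%C.
  by exists (Re e); [move: e0; rewrite ltcE => /andP[]|rewrite RRe_real ?gtr0_real].
pose d := r / 2.
have d0 : 0 < d by rewrite divr_gt0.
have d2 : 0 < d ^+ 2 by rewrite exprn_gt0.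
have [N1 H1] := fl _ d2; have [N2 H2] := natSinv_lt d0.
have Nl := leq_maxl N1 N2; have Nr := leq_maxr N1 N2.
have := Hf (maxn N1 N2); apply: filterS => h; rewrite !ball_fq ?invr_gt0// => hh.
have := H1 _ Nl; have := H2 _ Nr.
have := fqB_le completion_form l (f (maxn N1 N2)) h; rewrite (fqB _ l (f _)).
have p : 0 < (maxn N1 N2).+1%:R^-1 :> R by rewrite invr_gt0.
move: (_.+1%:R^-1) p hh => a; rewrite /d; nra.
Qed.

HB.instance Definition _ := Uniform_isComplete.Build completion complete_subproof.

Let cinner_bilinear : bilinear_for *%R (Num.conj \; *%R) cinner.
Proof.
split=> [g k x y|f k x y]; first exact: cinnerP.
by rewrite -[cinner]/(fs completion_form) fsDr fsZr.
Qed.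

HB.instance Definition _ := bilinear_isBilinear.Build R[i] completion completion R[i]
  *%R (Num.conj \; *%R) cinner cinner_bilinear.

Let cinner_herm f g : cinner f g = (-1) ^+ false * (cinner g f)^*.
Proof. by rewrite expr0 mul1r; exact: cinnerC. Qed.

HB.instance Definition _ := isHermitianSesquilinear.Build R[i] completion false
  (@Num.conj R[i]) cinner cinner_herm.

Let cinner_gt0 f : f != 0 -> 0 < cinner f f.
Proof.
move=> f0; rewrite -[cinner]/(fs completion_form) fs_diag ltcR lt_neqAle fq_ge0 andbT.
by rewrite eq_sym; apply: contra_neq f0; exact: cinner_def.
Qed.

HB.instance Definition _ := isDotProduct.Build R[i] completion cinner cinner_gt0.

Let cdot : {dot completion for (@Num.conj R[i])} := cinner.

Let cinner_norm f : cdot f f = `|f| ^+ 2.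
Proof.
by rewrite -[cdot _ _]/(completion_form f f) fs_diag cnormE -rmorphXn/= sqr_sqrtr ?fq_ge0.
Qed.

HB.instance Definition _ := isHilbert.Build R completion cinner_norm.

End Completion.

(** * Hilbert spaces as complete forms *)

Section HilbertForm.
Variables (R : realType) (H : hilbertType R).

Let hfsP (z : H) k x y : inner (k *: x + y) z = k * inner x z + inner y z.
Proof. by rewrite linearPl. Qed.

Let hfsC (x y : H) : inner y x = (inner x y)^*.
Proof. by rewrite hermC expr0 mul1r. Qed.

Let hfs_ge0 (x : H) : 0 <= Re (inner x x).
Proof.
have : 0 <= inner x x by rewrite inner_norm exprn_ge0.
by rewrite lecE => /andP[].
Qed.

Definition hform : form H := Form hfsP hfsC hfs_ge0.

Lemma hformE x y : hform x y = inner x y. Proof. by []. Qed.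

Lemma fq_hform (x : H) : fq hform x = Re `|x| ^+ 2.
Proof.
rewrite /fq hformE inner_norm -[in LHS](RRe_real (normr_real x)).
by rewrite -rmorphXn.
Qed.

Lemma fq_hform_eq0 (x : H) : fq hform x = 0 -> x = 0.
Proof.
move/eqP; rewrite fq_hform sqrf_eq0 => /eqP h; apply/eqP.
by rewrite -normr_eq0 -(RRe_real (normr_real x)) h.
Qed.

Lemma hnormE (x : H) : `|x| = (Num.sqrt (fq hform x))%:C%C.
Proof.
have : 0 <= `|x| by []; rewrite lecE /= => /andP[/eqP i0 r0].
by rewrite fq_hform sqrtr_sqr ger0_norm// RRe_real// normr_real.
Qed.

Lemma hform_complete : fcomplete hform.
Proof.
move=> u cu; have : cvgn u.
  apply: cauchy_cvg; apply: cauchy_exP => e e0.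
  have e1 : 0 < Re e by move: e0; rewrite ltcE => /andP[].
  have [N Hn] := cu _ (exprn_gt0 2 e1); exists (u N); exists N => // n /= Nn.
  have := Hn N n (leqnn _) Nn; rewrite -ball_normE /ball_ /= hnormE => h.
  rewrite -(RRe_real (gtr0_real e0)) ltcR -[ltRHS]gtr0_norm// -sqrtr_sqr.
  by rewrite ltr_sqrt ?exprn_gt0.
move=> /cvg_ex[l /cvgrPdist_lt ul]; exists l => e e0.
have p : 0 < (Num.sqrt e)%:C%C :> R[i] by rewrite ltcR sqrtr_gt0.
have [N _ Hn] := ul _ p; exists N => n /Hn /=.
by rewrite hnormE ltcR ltr_sqrt// fqB.
Qed.

End HilbertForm.

Section HilbertMaps.
Variables (R : realType) (H K : hilbertType R).

Lemma hilbert_bound (f : H -> K) (M : R) :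
  (forall x, fq (hform K) (f x) <= M * fq (hform H) x) ->
  forall x, `|f x| <= (Num.sqrt `|M|)%:C%C * `|x|.
Proof.
move=> fM x; rewrite !hnormE -rmorphM lecR -sqrtrM// ler_wsqrtr//.
by apply: le_trans (fM x) _; rewrite ler_wpM2r ?fq_ge0 ?ler_norm.
Qed.

Definition mk_blin (f : H -> K) (fl : linear f) (M : R)
    (fM : forall x, fq (hform K) (f x) <= M * fq (hform H) x) : blin H K :=
  BLin fl (bounded_continuous fl (hilbert_bound fM)).

Lemma blin_fq (f : blin H K) x :
  fq (hform K) (f x) <= Re `|f| ^+ 2 * fq (hform H) x.
Proof.
have : 0 <= `|f| by []; rewrite lecE /= => /andP[/eqP i0 r0].
have := blin_bound f x; rewrite -(RRe_real (normr_real f)).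
rewrite !hnormE -rmorphM lecR => h.
rewrite -[leLHS]sqr_sqrtr ?fq_ge0// -[X in _ * X]sqr_sqrtr ?fq_ge0// -exprMn.
by rewrite ler_pXn2r// ?nnegrE ?mulr_ge0 ?sqrtr_ge0.
Qed.

End HilbertMaps.

(** * Extending adjointable maps to completions *)

Section Extension.
Variables (R : realType) (E E' : lmodType R[i]) (s : form E) (s' : form E').

(** The adjoint is data because the extension to functionals is composition with it. [abound]
    compares squared norms. *)
Record adjointable := Adjointable {
  afun :> E -> E';
  aadj : E' -> E;
  abound : R;
  afunP : forall k x y, afun (k *: x + y) = k *: afun x + afun y;
  aadjE : forall x y, s' (afun x) y = s x (aadj y);
  aboundP : forall x, fq s' (afun x) <= abound * fq s x }.

Variable T : adjointable.

Lemma represented_map u (f : E -> R[i]) : represented_by s u f ->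
  represented_by s' (T \o u) (f \o aadj T).
Proof.
move=> [cu uf]; split=> [|y].
  apply: (fcauchy_map _ (aboundP T) cu) => x y.
  by rewrite addrC -scaleN1r afunP scaleN1r addrC.
by under eq_fun do rewrite /= aadjE; exact: uf.
Qed.

Let ext_subproof (f : completion s) : exists u, represented_by s' u (f \o aadj T).
Proof. by have [u uf] := completionP f; exists (T \o u); exact: represented_map. Qed.

(* The extension of T maps <x, .> to <T x, .> = <x, T^* .>. *)
Definition extension_fun (f : completion s) := Completion (ext_subproof f).

Let ext_linear : linear extension_fun.
Proof.
move=> k f g; apply: completion_eq => y; rewrite completionDE completionZE.
change ((k *: f + g) (aadj T y) = k * f (aadj T y) + g (aadj T y)).
by rewrite completionDE completionZE.
Qed.

Let ext_bound f : fq (hform (completion s')) (extension_fun f)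
  <= abound T * fq (hform (completion s)) f.
Proof.
have [u uf] := completionP f.
have h1 := @cinner_cvg _ _ _ _ _ (extension_fun f) (extension_fun f)
  (represented_map uf) (represented_map uf).
have h2 := @fcvgZ _ _ (cform R) (abound T)%:C%C _ _ (cinner_cvg uf uf).
rewrite -subr_ge0.
have := ccvg_Re (a := 0) (@fcvgB _ _ (cform R) _ _ _ _ h2 h1).
rewrite raddfB /= cReM /= mul0r subr0; apply => n.
rewrite raddfB /= cReM /= mul0r subr0 subr_ge0; exact: aboundP.
Qed.

Definition extension : blin (completion s) (completion s') :=
  mk_blin ext_linear ext_bound.

Lemma extension_to_completion x :
  extension (to_completion s x) = to_completion s' (T x).
Proof. by apply: completion_eq => y; rewrite /= aadjE. Qed.

End Extension.

Section ExtensionAdjoint.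
Variables (R : realType) (E E' : lmodType R[i]) (s : form E) (s' : form E').
Variables (T : adjointable s s') (T' : adjointable s' s).

Lemma extension_adjoint : aadj T =1 T' -> is_adjoint (extension T) (extension T').
Proof.
move=> TT' f g.
have [[u uf] [v vg]] := (completionP f, completionP g).
apply: (ccvg_unique (@cinner_cvg _ _ _ _ _ (extension T f) g (represented_map T uf) vg)).
under eq_fun do rewrite /= aadjE TT'.
exact: (@cinner_cvg _ _ _ _ _ f (extension T' g) uf (represented_map T' vg)).
Qed.

End ExtensionAdjoint.

(** * Unital C*-algebras and their representations *)

Section RealNorm.
Variables (R : realType) (V : normedModType R[i]).
Implicit Types x y : V.

Definition rnorm x : R := Re `|x|.

Lemma rnormE x : `|x| = (rnorm x)%:C%C.
Proof. by rewrite RRe_real ?normr_real. Qed.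
Lemma rnorm_ge0 x : 0 <= rnorm x.
Proof. by rewrite -ler0c -rnormE. Qed.
Lemma rnormD x y : rnorm (x + y) <= rnorm x + rnorm y.
Proof. by rewrite -lecR rmorphD /= -!rnormE ler_normD. Qed.
Lemma rnormN x : rnorm (- x) = rnorm x.
Proof. by rewrite /rnorm normrN. Qed.
Lemma rnormB x y : rnorm (x - y) = rnorm (y - x).
Proof. by rewrite -rnormN opprB. Qed.
Lemma rnormB_le x y : rnorm (x - y) <= rnorm x + rnorm y.
Proof. by rewrite -(rnormN y) rnormD. Qed.
Lemma rnormB_trans x y z : rnorm (x - z) <= rnorm (x - y) + rnorm (y - z).
Proof. by rewrite -[x - z](subrKA y) rnormD. Qed.
Lemma rnormZ k x : rnorm (k *: x) = Num.sqrt (normsq k) * rnorm x.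
Proof. by apply/complexI; rewrite rmorphM /= -!rnormE normrZ normc_def. Qed.
Lemma rnormZr (a : R) x : 0 <= a -> rnorm (a%:C%C *: x) = a * rnorm x.
Proof. by move=> a0; rewrite rnormZ normsq_real sqrtr_sqr ger0_norm. Qed.
Lemma rnorm0 : rnorm 0 = 0. Proof. by rewrite /rnorm normr0. Qed.
Lemma rnorm_eq0 x : rnorm x = 0 -> x = 0.
Proof. by move=> x0; apply/eqP; rewrite -normr_eq0 rnormE x0. Qed.

End RealNorm.

Lemma rnorm_complete (R : realType) (V : completeNormedModType R[i]) (u : nat -> V) :
  (forall e : R, 0 < e -> exists N, forall n, (N <= n)%N -> rnorm (u N - u n) < e) ->
  exists l, forall e : R, 0 < e -> exists N, forall n, (N <= n)%N -> rnorm (u n - l) < e.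
Proof.
move=> cu; have : cvgn u.
  apply: cauchy_cvg; apply: cauchy_exP => e e0.
  have e1 : 0 < Re e by move: e0; rewrite ltcE => /andP[].
  have [N Hn] := cu _ e1; exists (u N); exists N => // n /= /Hn.
  rewrite -ball_normE /ball_ /= rnormE => h.
  by rewrite -(RRe_real (gtr0_real e0)) ltcR.
move=> /cvg_ex[l /cvgrPdist_lt ul]; exists l => e e0.
have p : 0 < e%:C%C :> R[i] by rewrite ltcR.
by have [N _ Hn] := ul _ p; exists N => n /Hn /=; rewrite rnormE ltcR rnormB.
Qed.

Lemma bernoulli (R : realType) (d : R) n : 0 <= d -> 1 + n%:R * d <= (1 + d) ^+ n.
Proof.
move=> d0; elim: n => [|n IH]; first by rewrite mul0r addr0 expr0.
rewrite exprS; apply: (@le_trans _ _ ((1 + d) * (1 + n%:R * d))).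
  by rewrite -natr1; have := mulr_ge0 (ler0n R n) (sqr_ge0 d); lra.
by rewrite ler_wpM2l// addr_ge0.
Qed.

Lemma exp_lt1_cvg (R : realType) (r : R) : 0 <= r < 1 -> forall e : R, 0 < e ->
  exists n, r ^+ n < e.
Proof.
move=> /andP[]; rewrite le_eqVlt => /orP[/eqP<- _ e e0|r0 r1 e e0].
  by exists 1%N; rewrite expr1.
pose d := r^-1 - 1.
have d0 : 0 < d by rewrite subr_gt0 invf_gt1.
have [N /(_ _ (leqnn _)) H] := natSinv_lt (mulr_gt0 d0 e0); exists N.+1.
have p : 0 < N.+1%:R :> R by [].
have h : N.+1%:R * d <= (r ^+ N.+1)^-1.
  have -> : (r ^+ N.+1)^-1 = (1 + d) ^+ N.+1 by rewrite addrC subrK exprVn.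
  by apply: le_trans (bernoulli _ (ltW d0)); rewrite lerDr.
rewrite -ltf_pV2 ?posrE ?exprn_gt0//; apply: lt_le_trans h.
move: H; rewrite -ltf_pV2 ?posrE ?invr_gt0 ?mulr_gt0// invrK invfM mulrC.
by rewrite ltr_pdivrMr// mulrC.
Qed.

(** The powers of [r / a] tend to 0. Exponents [2 ^ n] are those produced by iterating
    Cauchy-Schwarz in [gns_bound]. *)
Lemma exp2n_unbounded (R : realType) (a r C : R) : 0 <= r -> r < a ->
  (forall n, a ^+ (2 ^ n) <= C * r ^+ (2 ^ n)) -> False.
Proof.
move=> r0 ra H; have a0 : 0 < a := le_lt_trans r0 ra.
have ra1 : 0 <= r / a < 1 by rewrite divr_ge0 ?(ltW a0)//= ltr_pdivrMr// mul1r.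
have C1 : 0 < (`|C| + 1)^-1 by rewrite invr_gt0 ltr_wpDl.
have [n Hn] := exp_lt1_cvg ra1 C1.
have : (r / a) ^+ (2 ^ n) < (`|C| + 1)^-1.
  apply: le_lt_trans Hn; case/andP: ra1 => h0 h1.
  by apply: ler_wiXn2l => //; [exact: ltW|exact/ltnW/ltn_expl].
have := H n; rewrite expr_div_n ltr_pdivrMr ?exprn_gt0//.
rewrite ltr_pdivlMl ?ltr_wpDl//.
have := exprn_ge0 (2 ^ n) r0; have := ler_norm C.
move: (a ^+ _) (r ^+ _) => A P; nra.
Qed.

(** * Neumann series and resolvents of self-adjoint elements *)

Section Algebra.
Variables (R : realType) (B : cstarAlgType R).
Implicit Types (a b h x y : B).

Lemma scalerAlB (k : R[i]) a b : k *: (a * b) = (k *: a) * b.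
Proof. exact: cscaleAl. Qed.
Lemma scalerArB (k : R[i]) a b : k *: (a * b) = a * (k *: b).
Proof. exact: cscaleAr. Qed.
Lemma star_mul a b : star (a * b) = star b * star a.
Proof. exact: starM. Qed.
Lemma star1 : star (1 : B) = 1.
Proof.
by rewrite -[RHS]starK -[star 1 in RHS]mulr1 star_mul starK mulr1.
Qed.
Lemma starN a : star (- a) = - star a.
Proof. by apply: (addrI (star a)); rewrite -starD !subrr star0. Qed.
Lemma rnormM a b : rnorm (a * b) <= rnorm a * rnorm b.
Proof. by rewrite -lecR rmorphM /= -!rnormE; exact: cnormM. Qed.
Lemma rnorm_star a : rnorm (star a) = rnorm a.
Proof. by rewrite /rnorm star_norm. Qed.
Lemma rnorm_starM a : rnorm (star a * a) = rnorm a ^+ 2.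
Proof. by apply/complexI; rewrite rmorphXn /= -!rnormE -cnorm_star. Qed.

(** The iterates of [y |-> 1 + h * y] from 0 are the partial sums of the geometric series. They
    commute with [h], hence so does their limit, which is why the inverse is two-sided. *)
Lemma neumann h : rnorm h < 1 -> exists y, y * (1 - h) = 1 /\ (1 - h) * y = 1.
Proof.
move=> h1; set r := rnorm h in h1; have r0 : 0 <= r := rnorm_ge0 h.
pose u n := iter n (fun y => 1 + h * y) 0.
(* The fixed point of [c = |1| + r c], so the iteration preserves this bound. *)
pose c := rnorm (1 : B) / (1 - r).
have c0 : 0 <= c by rewrite divr_ge0 ?rnorm_ge0// subr_ge0 ltW.
have uc n : rnorm (u n) <= c.
  elim: n => [|n IH]; first by rewrite rnorm0.
  rewrite /= (le_trans (rnormD _ _))//.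
  have := rnormM h (u n); rewrite -/r => h2.
  have : rnorm (1 : B) = c * (1 - r) by rewrite /c divfK// gt_eqF// subr_gt0.
  have := rnorm_ge0 (u n); nra.
have ucomm n : h * u n = u n * h.
  elim: n => [|n IH]; first by rewrite mulr0 mul0r.
  by rewrite /= mulrDr mulrDl mulr1 mul1r {1}IH mulrA.
have ud n k : rnorm (u (n + k)%N - u n) <= r ^+ n * c.
  elim: n => [|n IH]; first by rewrite add0n subr0 expr0 mul1r.
  rewrite addSn /= opprD addrACA subrr add0r -mulrBr exprS -mulrA.
  by rewrite (le_trans (rnormM _ _))// ler_wpM2l.
have [e e0|y uy] := @rnorm_complete _ _ u.
  have p : 0 < e / (c + 1) by rewrite divr_gt0// ltr_wpDl.
  have rr : 0 <= r < 1 by rewrite r0.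
  have [N HN] := exp_lt1_cvg rr p.
  exists N => n Nn; rewrite rnormB -(subnKC Nn); apply: le_lt_trans (ud _ _) _.
  move: HN; rewrite ltr_pdivlMr ?ltr_wpDl//; apply: le_lt_trans.
  by rewrite ler_wpM2l ?exprn_ge0// lerDl.
have lim0 x : (forall e : R, 0 < e -> rnorm x < e) -> x = 0.
  move=> H; apply: rnorm_eq0; apply/le_anti; rewrite rnorm_ge0 andbT leNgt.
  by apply/negP => /H; rewrite ltxx.
have fix1 : y - h * y - 1 = 0.
  apply: lim0 => e e0; have [N HN] := uy _ (div4_gt0 e0).
  have -> : y - h * y - 1 = (y - u N.+1) + h * (u N - y).
    by rewrite /= mulrBr opprD !addrA subrK addrAC.
  apply: le_lt_trans (rnormD _ _) _; rewrite rnormB.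
  have := HN _ (leqnSn N); have := HN _ (leqnn N).
  have := rnormM h (u N - y); have := rnorm_ge0 (u N - y); rewrite -/r; nra.
have fix2 : h * y - y * h = 0.
  apply: lim0 => e e0; have [N HN] := uy _ (div4_gt0 e0).
  have -> : h * y - y * h = h * (y - u N) + (u N - y) * h.
    by rewrite mulrBr mulrBl ucomm addrA subrK.
  apply: le_lt_trans (rnormD _ _) _.
  have := HN _ (leqnn N); have := rnormM h (y - u N); have := rnormM (u N - y) h.
  rewrite (rnormB y); have := rnorm_ge0 (u N - y); rewrite -/r; nra.
move/eqP: fix2; rewrite subr_eq0 => /eqP hy.
move/eqP: fix1; rewrite subr_eq0 => /eqP h2.
by exists y; rewrite mulrBr mulrBl mulr1 mul1r -hy.
Qed.

Let shift b (l : R) := b + ('i%C * l%:C%C) *: (1 : B).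
Let inverse b y := y * b = 1 /\ b * y = 1.

Let inverse_lr b y z : y * b = 1 -> b * z = 1 -> inverse b y.
Proof.
move=> yb bz; have yz : y = z by rewrite -[y]mulr1 -bz mulrA yb mul1r.
by split=> //; rewrite yz.
Qed.

Let normsq_i (l : R) : normsq ('i%C * l%:C%C) = l ^+ 2.
Proof. by rewrite /normsq /=; ring. Qed.

Let shift_star b (l : R) : star b = b -> star (shift b l) = shift b (- l).
Proof.
move=> sb; rewrite /shift starD sb starZ star1; congr (_ + _ *: _).
by apply: complexP; rewrite ?cReC ?cImC ?cReM ?cImM /=; ring.
Qed.

Let shift_bound b (l : R) y : star b = b -> 0 < l -> inverse (shift b l) y ->
  rnorm y * l <= 1.
Proof.
move=> sb l0 [yb by_].
have sy : star y * shift b (- l) = 1 by rewrite -shift_star// -star_mul by_ star1.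
have E : y - star y = - ('i%C * (2 * l)%:C%C) *: (star y * y).
  have e1 : star y * shift b (- l) * y = y by rewrite sy mul1r.
  have e2 : star y * shift b l * y = star y by rewrite -mulrA by_ mulr1.
  transitivity (star y * shift b (- l) * y - star y * shift b l * y).
    by rewrite e1 e2.
  rewrite -mulrBl -mulrBr.
  rewrite /shift opprD addrACA subrr add0r -scalerBl -scalerArB -scalerAlB mulr1.
  congr (_ *: _); apply: complexP; rewrite ?raddfB ?raddfN /= ?cReM ?cImM /=; ring.
have := congr1 (@rnorm R B) E; rewrite rnormZ normsqN normsq_i rnorm_starM.
rewrite sqrtr_sqr ger0_norm; last by lra.
move=> E'.
have := rnormB_le y (star y); rewrite rnorm_star E'.
have := rnorm_ge0 y; set t := rnorm y => t0 h.
by have [->|tp] := eqVneq t 0; [lra|have : 0 < t by rewrite lt_neqAle eq_sym tp]; nra.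
Qed.

(** With [y] inverse to [b + i l], one has [b + i m = (1 - h) (b + i l)] for [h = i (l - m) y], and
    [shift_bound] gives [|h| <= (l - m) / l < 1]. *)
Let shift_step b (l m : R) : star b = b -> 0 < l -> l < 2 * m -> m <= l ->
  (exists y, inverse (shift b l) y) -> exists y, inverse (shift b m) y.
Proof.
move=> sb l0 lm ml [y Hy]; have yl := shift_bound sb l0 Hy.
have [yb by_] := Hy.
pose h := ('i%C * (l - m)%:C%C) *: y.
have h1 : rnorm h < 1.
  rewrite rnormZ normsq_i sqrtr_sqr ger0_norm ?subr_ge0//.
  by have := rnorm_ge0 y; nra.
have [z [zh hz]] := neumann h1.
have E1 : shift b m = (1 - h) * shift b l.
  rewrite mulrBl mul1r /h -scalerAlB yb /shift -addrA -scalerBl; congr (_ + _ *: _).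
  by apply: complexP; rewrite ?raddfB /= ?cReM ?cImM /=; ring.
have E2 : shift b m = shift b l * (1 - h).
  rewrite mulrBr mulr1 /h -scalerArB by_ /shift -addrA -scalerBl; congr (_ + _ *: _).
  by apply: complexP; rewrite ?raddfB /= ?cReM ?cImM /=; ring.
exists (z * y); apply: (@inverse_lr _ _ (y * z)).
  by rewrite E2 mulrA -[z * y * _]mulrA yb mulr1.
by rewrite E1 mulrA -[_ * _ * y]mulrA by_ mulr1.
Qed.

(* From y - y^* = - 2 i l y^* y one gets |(b + i l)^-1| <= 1 / l, so invertibility of
   b + i l descends from large l to l = 1 by steps of ratio 3 / 2. *)
Lemma resolvent b : star b = b -> exists w, [/\ w * (b + 'i%C *: (1 : B)) = 1,
  (b + 'i%C *: (1 : B)) * w = 1 & rnorm w <= 1].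
Proof.
move=> sb.
pose q : R := 3 / 2.
have q0 : 0 < q by rewrite divr_gt0.
have start l : 0 < l -> rnorm b < l -> exists y, inverse (shift b l) y.
  move=> l0 bl; pose k : R[i] := ('i%C * l%:C%C).
  have k0 : k != 0.
    apply/eqP => /(congr1 (@normsq R)); rewrite normsq_i /normsq /= => h.
    by move: (exprn_gt0 2 l0); rewrite h expr0n addr0 ltxx.
  have kn : Num.sqrt (normsq k^-1) = l^-1.
    have : normsq k^-1 * normsq k = 1.
      by rewrite -normsqM mulVf// /normsq /= expr1n expr0n addr0.
    rewrite normsq_i => h; have -> : normsq k^-1 = l^-1 ^+ 2.
      have l2 : l ^+ 2 != 0 by rewrite gt_eqF ?exprn_gt0.
      by apply: (mulIf l2); rewrite h exprVn mulVf.
    by rewrite sqrtr_sqr ger0_norm// invr_ge0 ltW.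
  have h1 : rnorm (- (k^-1 *: b)) < 1.
    by rewrite rnormN rnormZ kn mulrC ltr_pdivrMr// mul1r.
  have [z [zh hz]] := neumann h1; exists (k^-1 *: z).
  have E : shift b l = k *: (1 - - (k^-1 *: b)).
    by rewrite opprK scalerDr scalerA mulfV// scale1r addrC.
  by split; rewrite E -scalerAlB -scalerArB scalerA ?mulVf ?mulfV ?scale1r.
have down n : (exists y, inverse (shift b (q ^+ n)) y) ->
    exists y, inverse (shift b 1) y.
  elim: n => [|n IH]; first by rewrite expr0.
  move=> /shift_step H; apply/IH/H => //; rewrite ?exprn_gt0// exprS.
    by have := exprn_gt0 n q0; rewrite /q; nra.
  by have := exprn_gt0 n q0; rewrite /q; nra.
have [n qn] : exists n, rnorm b < q ^+ n.
  have p : 0 < (rnorm b + 1)^-1 by rewrite invr_gt0 ltr_wpDl ?rnorm_ge0.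
  have qr : 0 <= q^-1 < 1 by rewrite invr_ge0 ltW//= invf_lt1// /q; lra.
  have [n Hn] := exp_lt1_cvg qr p; exists n.
  move: Hn; rewrite exprVn ltf_pV2 ?posrE ?exprn_gt0// ?ltr_wpDl ?rnorm_ge0//.
  by move=> h; lra.
have [y Hy] := down n (start _ (exprn_gt0 n q0) qn).
exists y; move: (Hy) => [] ; rewrite /shift mulr1 => -> ->; split=> //.
by have := shift_bound sb ltr01 Hy; rewrite mulr1.
Qed.

End Algebra.

(** * The semi-inner product of a positive functional *)

Section PositiveFunctional.
Variables (R : realType) (B : cstarAlgType R) (w : dual B).
Hypothesis wp : forall b, 0 <= (w (star b * b) : R[i]).

Let s (x y : B) : R[i] := w (star y * x).

Let sP z k x y : s (k *: x + y) z = k * s x z + s y z.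
Proof. by rewrite /s mulrDr -scalerArB linearP. Qed.

Let sDr z x y : s z (x + y) = s z x + s z y.
Proof. by rewrite /s starD mulrDl linearD. Qed.

Let sZr k z x : s z (k *: x) = k^* * s z x.
Proof. by rewrite /s starZ -scalerAlB linearZ. Qed.

Let s_im x : Im (s x x) = 0.
Proof. by have := wp x; rewrite lecE => /andP[/eqP]. Qed.

(** Polarization: positivity makes the form real at [k x + y], and [k = 1] and [k = i] give the two
    components. *)
Let sC x y : s y x = (s x y)^*.
Proof.
have h k : Im (k * s x y) + Im (k^* * s y x) = 0.
  have := s_im (k *: x + y); rewrite sP !sDr !sZr mulrDr !raddfD /=.
  rewrite !cImM !cReM !cReC !cImC !s_im; lra.
have := h 1; have := h 'i%C; rewrite !cImM !cReC !cImC /= => h1 h2.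
by apply: complexP; rewrite ?cReC ?cImC; lra.
Qed.

Let s_ge0 x : 0 <= Re (s x x).
Proof. by have := wp x; rewrite lecE => /andP[]. Qed.

Definition gns_form : form B := Form sP sC s_ge0.

Let fq_bound x : fq gns_form x <= rnorm w * rnorm x ^+ 2.
Proof.
apply: le_trans (_ : rnorm (w (star x * x) : R[i]^o) <= _).
  rewrite /rnorm normc_def /=; apply: le_trans (ler_norm _) _.
  by rewrite -sqrtr_sqr ler_wsqrtr// lerDl sqr_ge0.
by have := blin_bound w (star x * x); rewrite !rnormE -rmorphM lecR rnorm_starM.
Qed.

(* Iterating Cauchy-Schwarz bounds (|b x|^2 / |x|^2)^(2^n) by |w| |x|^2 |b|^(2^(n+1)) / |x|^2. *)
Lemma gns_bound b x : fq gns_form (b * x) <= rnorm b ^+ 2 * fq gns_form x.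
Proof.
set F := fq gns_form x; have F0 : 0 <= F := fq_ge0 _ _.
pose h := star b * b; pose k n := h ^+ (2 ^ n).
have kstar n : star (k n) = k n.
  elim: n => [|n IH]; first by rewrite /k expn0 expr1 star_mul starK.
  by rewrite /k expnS mul2n -addnn exprD star_mul -/(k n) IH.
have kr n : rnorm (k n) <= (rnorm b ^+ 2) ^+ (2 ^ n).
  elim: n => [|n IH]; first by rewrite /k expn0 !expr1 rnorm_starM.
  rewrite /k expnS mul2n -addnn !exprD; apply: le_trans (rnormM _ _) _.
  by rewrite ler_pM ?rnorm_ge0.
have E0 : fq gns_form (b * x) ^+ 2 <= fq gns_form (k 0%N * x) * F.
  have -> : fq gns_form (b * x) ^+ 2 = normsq (gns_form (k 0%N * x) x).
    rewrite -normsq_real -fs_diag /= /s star_mul /k expn0 expr1.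
    by rewrite !mulrA.
  exact: fCS.
(* [k n] is self-adjoint with square [k n.+1], so [fq (k n * x)] is the form at [k n.+1 * x] and
   [x]. *)
have E n : fq gns_form (k n * x) ^+ 2 <= fq gns_form (k n.+1 * x) * F.
  have -> : fq gns_form (k n * x) ^+ 2 = normsq (gns_form (k n.+1 * x) x).
    rewrite -normsq_real -fs_diag /= /s star_mul kstar /k expnS mul2n -addnn exprD.
    by rewrite !mulrA.
  exact: fCS.
have [F1|Fn] := eqVneq F 0.
  by move: E0; rewrite F1 !mulr0; have := fq_ge0 gns_form (b * x); nra.
have Fp : 0 < F by rewrite lt_neqAle eq_sym Fn.
pose A := fq gns_form (b * x) / F.
have A0 : 0 <= A by rewrite divr_ge0 ?fq_ge0.
have AE n : (A ^+ 2) ^+ (2 ^ n) <= fq gns_form (k n * x) / F.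
  elim: n => [|n IH].
    rewrite expn0 expr1 expr_div_n ler_pdivrMr ?exprn_gt0//.
    by rewrite expr2 mulrA divfK.
  rewrite expnS mulnC exprM; apply: (@le_trans _ _ ((fq gns_form (k n * x) / F) ^+ 2)).
    by rewrite ler_pXn2r// ?nnegrE ?exprn_ge0 ?divr_ge0 ?fq_ge0.
  rewrite expr_div_n ler_pdivrMr ?exprn_gt0//.
  by rewrite [in leRHS]expr2 mulrA divfK//; exact: E.
rewrite -ler_pdivrMr// leNgt; apply/negP => bA.
have r2 : (rnorm b ^+ 2) ^+ 2 < A ^+ 2 by rewrite ltr_pXn2r// nnegrE sqr_ge0.
apply: (@exp2n_unbounded _ _ _ (rnorm w * rnorm x ^+ 2 / F) (sqr_ge0 _) r2) => n.
apply: le_trans (AE n) _; rewrite mulrAC ler_wpM2r ?invr_ge0//.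
apply: le_trans (fq_bound _) _; rewrite -mulrA ler_wpM2l ?rnorm_ge0//.
apply: (@le_trans _ _ ((rnorm (k n) * rnorm x) ^+ 2)).
  by rewrite ler_pXn2r// ?nnegrE ?mulr_ge0 ?rnorm_ge0// rnormM.
rewrite exprMn mulrC ler_wpM2l ?sqr_ge0// -exprM mulnC exprM.
have := kr n; have := rnorm_ge0 (k n); move: (_ ^+ (2 ^ n)) (rnorm (k n)) => Q q; nra.
Qed.

End PositiveFunctional.

(** * Representations are contractive *)

Section Representation.
Variables (R : realType) (B : cstarAlgType R) (H : hilbertType R).
Variables (pi : B -> blin H H) (hpi : star_representation pi).

Lemma opnorm_sq_le (K : hilbertType R) (f : blin H K) (M : R) : 0 <= M ->
  (forall x, fq (hform K) (f x) <= M * fq (hform H) x) -> rnorm f ^+ 2 <= M.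
Proof.
move=> M0 fM; rewrite -[leRHS]sqr_sqrtr// ler_pXn2r// ?nnegrE ?rnorm_ge0 ?sqrtr_ge0//.
apply: opnorm_le => x x1; apply: le_trans (hilbert_bound fM x) _.
by rewrite ger0_norm// ler_piMr// ler0c sqrtr_ge0.
Qed.

Lemma repr_fs b x y : hform H (pi b x) y = hform H x (pi (star b) y).
Proof. exact: (repr_star hpi). Qed.

Lemma reprME a b x : pi (a * b) x = pi a (pi b x).
Proof. by rewrite (reprM hpi). Qed.

Lemma repr1E x : pi 1 x = x.
Proof. by rewrite (repr1 hpi). Qed.

Lemma reprlE k a b x : pi (k *: a + b) x = k *: pi a x + pi b x.
Proof. by rewrite (repr_linear hpi). Qed.

Lemma reprDE a b x : pi (a + b) x = pi a x + pi b x.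
Proof. by have := reprlE 1 a b x; rewrite !scale1r. Qed.

Lemma repr0E x : pi 0 x = 0.
Proof. by apply: (addrI (pi 0 x)); rewrite -reprDE !addr0. Qed.

Lemma reprZE k a x : pi (k *: a) x = k *: pi a x.
Proof. by have := reprlE k a 0 x; rewrite !addr0 repr0E addr0. Qed.

(* If t = |pi b|^2 > |b|^2 then t - b^* b is invertible in B, so t - pi (b)^* pi (b) is
   bounded below and t is not the best constant. *)
Lemma repr_contractive b x :
  fq (hform H) (pi b x) <= rnorm b ^+ 2 * fq (hform H) x.
Proof.
pose t := rnorm (pi b) ^+ 2.
have bt z : fq (hform H) (pi b z) <= t * fq (hform H) z by exact: blin_fq.
have [tb|tb] := leP t (rnorm b ^+ 2).
  by apply: le_trans (bt x) _; rewrite ler_wpM2r ?fq_ge0.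
exfalso; have t0 : 0 < t by apply: le_lt_trans tb; rewrite sqr_ge0.
(* The adjoint obeys the same bound, by Cauchy-Schwarz for [z] and [pi b (pi (star b) z)]. *)
have bst z : fq (hform H) (pi (star b) z) <= t * fq (hform H) z.
  have := fCS (hform H) z (pi b (pi (star b) z)).
  have E : hform H z (pi b (pi (star b) z)) = (fq (hform H) (pi (star b) z))%:C%C.
    by rewrite -fs_diag repr_fs starK.
  rewrite E normsq_real; have := bt (pi (star b) z).
  have := fq_ge0 (hform H) z; have := fq_ge0 (hform H) (pi (star b) z).
  move: (fq _ (pi (star b) z)) (fq _ (pi b _)) (fq _ z) => u v w u0 w0 h1 h2.
  have [->|up] := eqVneq u 0; first by rewrite mulr_ge0// ltW.
  have : 0 < u by rewrite lt_neqAle eq_sym up.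
  nra.
have h1 : rnorm (t^-1%:C%C *: (star b * b)) < 1.
  by rewrite rnormZr ?invr_ge0 ?ltW// rnorm_starM mulrC ltr_pdivrMr// mul1r.
have [y [yh _]] := neumann h1.
pose c := rnorm (pi y) ^+ 2.
have key z : fq (hform H) z <= c * (fq (hform H) z - t^-1 * fq (hform H) (pi b z)).
  have E : z = pi y (z - t^-1%:C%C *: pi (star b) (pi b z)).
    rewrite -[LHS]repr1E -yh reprME; congr (pi y _).
    by rewrite reprDE repr1E -scaleN1r reprZE reprZE scaleN1r reprME.
  rewrite {1}E; apply: le_trans (blin_fq _ _) _; rewrite -/c ler_wpM2l ?sqr_ge0//.
  rewrite fqBE fqZ normsq_real fsZr -repr_fs fs_diag cReM cReC cImC /= mulr0 subr0.
  have := bst (pi b z); have ti : 0 < t^-1 by rewrite invr_gt0.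
  move: (fq _ (pi (star b) _)) (fq _ (pi b z)) (fq _ z) => u v w h.
  have : t^-1 ^+ 2 * u <= t^-1 * v.
    by rewrite expr2 -mulrA ler_pM2l// ler_pdivrMl.
  lra.
have c0 : 0 <= c by exact: sqr_ge0.
have := bt x; have := fq_ge0 (hform H) x.
have M0 : 0 <= t * c / (c + 1).
  by apply: divr_ge0; [apply: mulr_ge0 => //; exact: ltW|lra].
(* [key] combined with [bt] gives [(c + 1) * fq (pi b z) <= t * c * fq z], which improves the
   constant [t] and contradicts its minimality. *)
have : t <= t * c / (c + 1).
  apply: opnorm_sq_le => // z.
  have := key z; have := fq_ge0 (hform H) z; have := bt z.
  move: (fq _ (pi b z)) (fq _ z) => v w bv w0 h.
  rewrite mulrAC ler_pdivlMr ?ltr_wpDl//.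
  have : t * w <= c * (t * w - v).
    have -> : c * (t * w - v) = t * (c * (w - t^-1 * v)) by field; rewrite gt_eqF.
    by rewrite ler_pM2l.
  lra.
rewrite ler_pdivlMr ?ltr_wpDl//; nra.
Qed.

End Representation.

(** * Dilations *)

Lemma blin_lin (R : realType) (E F : normedModType R[i]) (f : blin E F) k x y :
  f (k *: x + y) = k *: f x + f y.
Proof. exact: blin_linear. Qed.

Lemma blinZ (R : realType) (E F : normedModType R[i]) (f : blin E F) k x :
  f (k *: x) = k *: f x.
Proof. by rewrite linearZ. Qed.

Section VectorFunctional.
Variables (R : realType) (B : cstarAlgType R) (H : hilbertType R).
Variables (pi : B -> blin H H) (hpi : star_representation pi) (v : H).

Let vec_linear : linear (fun b => inner (pi b v) v : R[i]^o).
Proof. by move=> k a b; rewrite (reprlE hpi) linearPl. Qed.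

Let vec_bound b : `|inner (pi b v) v : R[i]^o| <= (fq (hform H) v)%:C%C * `|b|.
Proof.
rewrite !rnormE -rmorphM lecR.
rewrite -(ler_pXn2r (n := 2))// ?nnegrE ?mulr_ge0 ?fq_ge0 ?rnorm_ge0//.
rewrite [leLHS](_ : _ = normsq (inner (pi b v) v)); last by rewrite normsqE.
apply: le_trans (fCS (hform H) _ _) _.
have := repr_contractive hpi b v; have := fq_ge0 (hform H) v; nra.
Qed.

Definition vector_functional : dual B :=
  BLin vec_linear (bounded_continuous vec_linear vec_bound).

Lemma vector_functional_fq b :
  vector_functional (star b * b) = (fq (hform H) (pi b v))%:C%C.
Proof.
by rewrite /= (reprME hpi) -[LHS](hformE) (repr_fs hpi) starK fs_diag.
Qed.

Lemma vector_functional_state : fq (hform H) v = 1 -> is_state vector_functional.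
Proof.
move=> v1; split=> [b|]; first by rewrite vector_functional_fq ler0c fq_ge0.
by rewrite /= (repr1E hpi) -hformE fs_diag v1.
Qed.

Definition repr_action : action B (hform H).
Proof.
exists (fun b x => pi b x).
- by move=> b k x y; rewrite linearP.
- exact: (reprlE hpi).
- exact: (repr1E hpi).
- exact: (reprME hpi).
- exact: (repr_fs hpi).
Defined.

End VectorFunctional.

Section Dilation.
Variables (R : realType) (B : cstarAlgType R) (S : set B).

Record dilation (H K : hilbertType R) (pi : B -> blin H H) (sigma : B -> blin K K)
    (V : blin H K) (Vs : blin K H) : Prop := Dilation {
  dil_repr : star_representation pi;
  dil_repr' : star_representation sigma;
  dil_iso : forall x, `|V x| = `|x|;
  dil_adj : is_adjoint V Vs;
  dil_compress : forall a, S a -> pi a = blin_comp Vs (blin_comp (sigma a) V) }.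

Section Intertwine.
Variables (H K : hilbertType R) (pi : B -> blin H H) (sigma : B -> blin K K).
Variables (V : blin H K) (Vs : blin K H).

Definition intertwined x := forall b, sigma b (V x) = V (pi b x).

Hypothesis dil : dilation pi sigma V Vs.
Let hpi := dil_repr dil.
Let hsigma := dil_repr' dil.

Lemma fq_isometry x : fq (hform K) (V x) = fq (hform H) x.
Proof. by rewrite !fq_hform (dil_iso dil). Qed.

Lemma intertwinedP k x y : intertwined x -> intertwined y -> intertwined (k *: x + y).
Proof. by move=> hx hy b; rewrite !blin_lin hx hy. Qed.

Lemma intertwined0 : intertwined 0.
Proof. by move=> b; rewrite !linear0. Qed.

Lemma intertwined_act a x : intertwined x -> intertwined (pi a x).
Proof. by move=> hx b; rewrite -(reprME hpi) -!hx (reprME hsigma). Qed.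

Lemma intertwined_closed u x : fcvg (hform H) u x -> (forall n, intertwined (u n)) ->
  intertwined x.
Proof.
move=> ux hu b; apply/eqP; rewrite -subr_eq0; apply/eqP/fq_hform_eq0.
have h1 : fcvg (hform K) (fun n => sigma b (V (u n))) (sigma b (V x)).
  apply: (fcvg_map (T := fun x => sigma b (V x)) (M := rnorm b ^+ 2) _ _ ux) => [y z|y].
    by rewrite !linearB.
  by apply: le_trans (repr_contractive hsigma _ _) _; rewrite fq_isometry.
have h2 : fcvg (hform K) (fun n => V (pi b (u n))) (V (pi b x)).
  apply: (fcvg_map (T := fun x => V (pi b x)) (M := rnorm b ^+ 2) _ _ ux) => [y z|y].
    by rewrite !linearB.
  by rewrite fq_isometry; exact: repr_contractive.
apply: fcvg_unique h1 _; rewrite (_ : (fun n => _) = (fun n => V (pi b (u n))))//.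
by apply/funext => n; exact: hu.
Qed.

Lemma dilation_cancel x : S 1 -> Vs (V x) = x.
Proof.
move=> S1; have := congr1 (fun f => f x) (congr1 (@blin_fun _ _ _) (dil_compress dil S1)).
by rewrite /= (repr1E hpi) (repr1E hsigma).
Qed.

(** The equality case of contractivity of [Vs]: [|y - V x|^2] expands with cross term
    [<y, V x> = <Vs y, x> = |x|^2]. *)
Lemma isometry_range x y : Vs y = x -> fq (hform K) y = fq (hform H) x -> y = V x.
Proof.
move=> yx qxy; apply/eqP; rewrite -subr_eq0; apply/eqP/fq_hform_eq0.
rewrite fqBE fq_isometry qxy.
have -> : Re (hform K y (V x)) = fq (hform H) x.
  by rewrite fsC cReC hformE (dil_adj dil) yx.
ring.
Qed.

Hypotheses (hS : operator_system S) (hgen : cstar_generated S = [set: B]).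
Variable psi : dual B.
Hypotheses (hpsi : is_state psi) (hmax : dilation_maximal S psi).

(** Maximality identifies the dilated state with [psi], whence the norm equality [qq]. If the defect
    [D] vanishes at [b], then [isometry_range] makes it vanish at [a b] for [a] in [S]. The
    multipliers preserving the vanishing of [D] contain a C*-algebra including [S], hence are all of
    [B], and [D 1 = 0]. *)
Lemma maximal_intertwined x : (forall b, psi b = inner (pi b x) x) -> intertwined x.
Proof.
move=> psix.
have x1 : fq (hform H) x = 1.
  by have := psix 1; rewrite (repr1E hpi) -hformE fs_diag hpsi.2 => -[].
have nx : `|x| = 1 by rewrite hnormE x1 sqrtr1.
have nVx : `|V x| = 1 by rewrite (dil_iso dil).
have Vx1 : fq (hform K) (V x) = 1 by rewrite fq_isometry.
have chi_psi : vector_functional hsigma (V x) = psi.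
  apply: hmax; split=> //; first exact: vector_functional_state.
  exists H, K, pi, x, sigma, (V x), V, Vs; split=> //.
  - by split; [exact: (dil_iso dil)|].
  - exact: (dil_adj dil).
  - exact: (dil_compress dil).
have qq b : fq (hform K) (sigma b (V x)) = fq (hform H) (pi b x).
  apply: complexI; rewrite -vector_functional_fq chi_psi psix.
  by rewrite (reprME hpi) -hformE (repr_fs hpi) starK fs_diag.
pose D b := sigma b (V x) - V (pi b x).
have DP k a b : D (k *: a + b) = k *: D a + D b.
  rewrite /D (reprlE hsigma) (reprlE hpi) linearP opprD addrACA.
  by rewrite scalerBr.
have DB a b : D (a - b) = D a - D b.
  by rewrite addrC -scaleN1r DP scaleN1r addrC.
have Dq b : fq (hform K) (D b) <= 4 * rnorm b ^+ 2.
  apply: le_trans (fqD_le _ _ _) _; rewrite fqN fq_isometry.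
  have := repr_contractive hsigma b (V x); have := repr_contractive hpi b x.
  rewrite Vx1 x1; lra.
have DM a b : S a -> D b = 0 -> D (a * b) = 0.
  move=> Sa /eqP; rewrite subr_eq0 => /eqP Db.
  apply/eqP; rewrite subr_eq0; apply/eqP/isometry_range; last exact: qq.
  rewrite (reprME hsigma) Db (reprME hpi).
  by have := congr1 (fun f => f (pi b x)) (congr1 (@blin_fun _ _ _) (dil_compress dil Sa)).
(* The clause on [star a] builds self-adjointness into [A]. *)
pose A := [set a : B | forall b, D b = 0 -> D (a * b) = 0 /\ D (star a * b) = 0].
have D0 : D 0 = 0 by have := DB 0 0; rewrite !subrr.
have AS : A = [set: B].
  apply/seteqP; split=> // b _.
  have : cstar_generated S b by rewrite hgen.
  apply; split; last first.
    move=> a Sa c Dc; split; apply: DM => //.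
    by case: hS => _ h _; exact: h.
  split.
  - split=> [c Dc|k a c Aa Ac d Dd]; first by rewrite star0 !mul0r.
    have [a1 a2] := Aa _ Dd; have [c1 c2] := Ac _ Dd.
    rewrite starD starZ !mulrDl -!scalerAlB !DP a1 a2 c1 c2 !scaler0.
    by rewrite !addr0.
  - by move=> a Aa c Dc; rewrite starK and_comm; exact: Aa.
  - move=> a c Aa Ac d Dd; rewrite star_mul -!mulrA.
    have [a1 a2] := Aa _ Dd; have [c1 c2] := Ac _ Dd.
    by split; [exact: (Aa _ c1).1|exact: (Ac _ a2).2].
  - move=> p pA c Dc.
    have near (e : R) : 0 < e -> exists a, A a /\ rnorm (p - a) < e.
      move=> e0; have p0 : 0 < e%:C%C :> R[i] by rewrite ltcR.
      have [a [Aa]] := pA _ (nbhsx_ballx p _ p0).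
      by rewrite -ball_normE /ball_ /= rnormE ltcR => ?; exists a.
    have small y : (forall e : R, 0 < e -> fq (hform K) y <= e) -> y = 0.
      move=> h; apply: fq_hform_eq0; apply/le_anti; rewrite fq_ge0 andbT leNgt.
      by apply/negP => y0; have := h _ (div4_gt0 y0); lra.
    (* By [Dq] the quantity is at most [4 |d|^2 |c|^2], and [|d| < 1] lets [|d|^2] be replaced by
       [|d|]. *)
    have bnd (d : B) (e : R) : 0 < e -> rnorm d < Num.min 1 (e / (4 * (rnorm c ^+ 2 + 1))) ->
        fq (hform K) (D (d * c)) <= e.
      move=> e0; rewrite lt_min => /andP[d1].
      have p1 : 0 < 4 * (rnorm c ^+ 2 + 1) by have := sqr_ge0 (rnorm c); lra.
      rewrite ltr_pdivlMr// => d2; apply: le_trans (Dq _) _.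
      have h1 : rnorm (d * c) ^+ 2 <= rnorm d ^+ 2 * rnorm c ^+ 2.
        by rewrite -exprMn ler_pXn2r// ?nnegrE ?mulr_ge0 ?rnorm_ge0 ?rnormM.
      have := rnorm_ge0 d; have := sqr_ge0 (rnorm c).
      move: (rnorm c ^+ 2) (rnorm d) (rnorm (d * c) ^+ 2) h1 d1 d2 => m r t h1 d1 d2 m0 r0.
      have : r ^+ 2 * m <= r * m by rewrite ler_wpM2r//; nra.
      nra.
    have pos (e : R) : 0 < e -> 0 < Num.min 1 (e / (4 * (rnorm c ^+ 2 + 1))).
      move=> e0; rewrite lt_min ltr01 divr_gt0//.
      by have := sqr_ge0 (rnorm c); lra.
    split; apply: small => e e0; have [a [Aa pa]] := near _ (pos _ e0).
      rewrite -(subrK a p) mulrDl -[_ * c]scale1r DP (Aa _ Dc).1 addr0 scale1r.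
      exact: bnd.
    rewrite -(subrK (star a) (star p)) mulrDl -[_ * c]scale1r DP (Aa _ Dc).2 addr0 scale1r.
    have -> : star p - star a = star (p - a) by rewrite starD starN.
    by apply: bnd; rewrite ?rnorm_star.
have D1 : D 1 = 0 by rewrite /D (repr1E hsigma) (repr1E hpi) subrr.
move=> b; apply/eqP; rewrite -subr_eq0 -[_ - _]/(D b).
have : A b by rewrite AS.
by move=> /(_ _ D1)[+ _]; rewrite mulr1 => ->.
Qed.

End Intertwine.
End Dilation.

(** * Adjoining a GNS summand to a dilation *)

Section Enlarge.
Variables (R : realType) (B : cstarAlgType R) (w : dual B).
Hypothesis wp : forall b, 0 <= (w (star b * b) : R[i]).

(** The summand [B] is the GNS space of [w] before completion, with cyclic vector [1]; its null
    vectors become 0 in [enlarge]. *)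
Definition enlarge_form (H : hilbertType R) := pair_form (hform H) (gns_form wp).

Definition enlarge (H : hilbertType R) := completion (enlarge_form H).

Lemma enlarge_fst_inj (H : hilbertType R) (x y : H) (a : B) :
  to_completion (enlarge_form H) (x, a) = to_completion (enlarge_form H) (y, a) -> x = y.
Proof.
move=> /eqP; rewrite -subr_eq0 -to_completionB => /eqP E.
have := fq_to_completion (enlarge_form H) ((x, a) - (y, a)).
rewrite E fq0 fq_pair /= subrr fq0 addr0 => /esym/fq_hform_eq0/eqP.
by rewrite subr_eq0 => /eqP.
Qed.

Section OneRepr.
Variables (H : hilbertType R) (pi : B -> blin H H) (hpi : star_representation pi).

Let T b (z : H * B) : H * B := (pi b z.1, b * z.2).

Let TP b k x y : T b (k *: x + y) = k *: T b x + T b y.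
Proof. by rewrite /T /= linearP mulrDr -scalerArB. Qed.

Let T_adj b x y : enlarge_form H (T b x) y = enlarge_form H x (T (star b) y).
Proof.
rewrite /= /pair_fs /= (repr_star hpi); congr (_ + _).
by rewrite star_mul starK mulrA.
Qed.

Let T_bound b x :
  fq (enlarge_form H) (T b x) <= rnorm b ^+ 2 * fq (enlarge_form H) x.
Proof. by rewrite !fq_pair mulrDr lerD ?repr_contractive ?gns_bound. Qed.

Definition enlarge_adj b := Adjointable (TP b) (T_adj b) (T_bound b).

Definition enlarge_repr b := extension (enlarge_adj b).

Lemma enlarge_reprE b x a : enlarge_repr b (to_completion _ (x, a)) =
  to_completion _ (pi b x, b * a).
Proof. exact: extension_to_completion. Qed.

Lemma enlarge_repr_fun b (f : enlarge H) x a :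
  enlarge_repr b f (x, a) = f (pi (star b) x, star b * a).
Proof. by []. Qed.

Lemma enlarge_representation : star_representation enlarge_repr.
Proof.
split.
- move=> k a b; apply: blinP => f; apply: completion_eq => -[x c].
  rewrite [RHS]completionDE [X in _ = X + _]completionZE !enlarge_repr_fun.
  have -> : (pi (star (k *: a + b)) x, star (k *: a + b) * c) =
      k^* *: (pi (star a) x, star a * c) + (pi (star b) x, star b * c).
    by rewrite starD starZ (reprlE hpi) mulrDl -scalerAlB.
  by rewrite completion_antilinear conjCK.
- apply: blinP => f; apply: completion_eq => -[x c].
  by rewrite enlarge_repr_fun star1 (repr1E hpi) mul1r.
- move=> a b; apply: blinP => f; apply: completion_eq => -[x c].
  by rewrite !enlarge_repr_fun star_mul (reprME hpi) mulrA.
- by move=> a; apply: extension_adjoint.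
Qed.

End OneRepr.

Section OneMap.
Variables (H K : hilbertType R) (V : blin H K) (Vs : blin K H).
Hypothesis VVs : is_adjoint V Vs.

Let T (z : H * B) : K * B := (V z.1, z.2).

Let TP k x y : T (k *: x + y) = k *: T x + T y.
Proof. by rewrite /T /= linearP. Qed.

Let T_adj x y : enlarge_form K (T x) y = enlarge_form H x (Vs y.1, y.2).
Proof. by rewrite /= /pair_fs /= VVs. Qed.

Let T_bound x :
  fq (enlarge_form K) (T x) <= (rnorm V ^+ 2 + 1) * fq (enlarge_form H) x.
Proof.
rewrite !fq_pair /=; have := blin_fq V x.1; have := fq_ge0 (hform H) x.1.
have := fq_ge0 (gns_form wp) x.2; have := sqr_ge0 (rnorm V).
rewrite -/(rnorm V); nra.
Qed.

Definition enlarge_map_adj := Adjointable TP T_adj T_bound.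

Definition enlarge_map : blin (enlarge H) (enlarge K) := extension enlarge_map_adj.

Lemma enlarge_mapE x a : enlarge_map (to_completion _ (x, a)) = to_completion _ (V x, a).
Proof. exact: extension_to_completion. Qed.

Lemma enlarge_map_fun (f : enlarge H) x a : enlarge_map f (x, a) = f (Vs x, a).
Proof. by []. Qed.

End OneMap.

Lemma is_adjoint_sym (H K : hilbertType R) (V : blin H K) (Vs : blin K H) :
  is_adjoint V Vs -> is_adjoint Vs V.
Proof. by move=> h x y; rewrite -!hformE fsC hformE -h -hformE -fsC. Qed.

(** The isometry is [V] plus the identity of the GNS summand, where both enlarged representations
    act by the same left multiplication. *)
Lemma enlarge_dilation S (H K : hilbertType R) (pi : B -> blin H H)
    (sigma : B -> blin K K) (V : blin H K) (Vs : blin K H)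
    (dil : dilation S pi sigma V Vs) : operator_system S ->
  dilation S (enlarge_repr (dil_repr dil)) (enlarge_repr (dil_repr' dil))
    (enlarge_map (dil_adj dil)) (enlarge_map (is_adjoint_sym (dil_adj dil))).
Proof.
move=> [_ Ssa S1].
have adj : is_adjoint (enlarge_map (dil_adj dil))
    (enlarge_map (is_adjoint_sym (dil_adj dil))) by apply: extension_adjoint.
have VsV x : Vs (V x) = x by exact: dilation_cancel dil x S1.
split=> //.
- exact: enlarge_representation.
- exact: enlarge_representation.
- move=> f; rewrite !hnormE /fq !hformE adj; congr (Num.sqrt (Re (inner f _)))%:C%C.
  by apply: completion_eq => -[x c]; rewrite !enlarge_map_fun VsV.
- move=> a Sa; apply: blinP => f; apply: completion_eq => -[x c].
  rewrite /= /enlarge_adj /=.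
  (* Operators act on functionals through their adjoints, so the compression identity is needed at
     [star a]. *)
  have := congr1 (fun f => f x) (congr1 (@blin_fun _ _ _) (dil_compress dil (Ssa _ Sa))).
  by move=> /= ->.
Qed.

End Enlarge.

(** * Dominated vectors are intertwined *)

Section Dominated.
Variables (R : realType) (B : cstarAlgType R) (S : set B).
Hypotheses (hS : operator_system S) (hgen : cstar_generated S = [set: B]).
Variable psi : dual B.
Hypotheses (hpsi : is_state psi) (hmax : dilation_maximal S psi).
Variables (H K : hilbertType R) (pi : B -> blin H H) (sigma : B -> blin K K).
Variables (V : blin H K) (Vs : blin K H) (dil : dilation S pi sigma V Vs).

Lemma dominated_intertwined z :
  dominated psi (repr_action (dil_repr dil)) z -> intertwined pi sigma V z.
Proof.
move=> [C [C0 HC]].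
have c0 : 0 < (C + 1)^-1 by rewrite invr_gt0 ltr_wpDl.
(* Since [C / (C + 1) <= 1], the vector functional of [x = c z] lies below [psi], so [w] is
   positive. The 1 keeps [c] well defined and nonzero when [C = 0]. *)
pose c : R := Num.sqrt (C + 1)^-1.
have cn : c != 0 by rewrite sqrtr_eq0 -ltNge.
pose x := c%:C%C *: z.
pose w : dual B := psi - vector_functional (dil_repr dil) x.
have wE b : w b = psi b - inner (pi b x) x.
  by rewrite /w /= [LHS]/(psi b + -1 *: _) scaleN1r.
have wp b : 0 <= (w (star b * b) : R[i]).
  have := hpsi.1 b; rewrite wE -[inner _ _]/(vector_functional (dil_repr dil) x _).
  rewrite vector_functional_fq !lecE !raddfB /= subr0 => /andP[/eqP -> h].
  rewrite eqxx subr_ge0 /= linearZ /= fqZ normsq_real sqr_sqrtr ?(ltW c0)//.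
  have := HC b; rewrite /= => h2; rewrite ler_pdivrMl ?ltr_wpDl//.
  apply: le_trans h2 _; have := h; rewrite /=; nra.
(* The first component contributes the vector functional of [x] and the second [w]; their sum is
   [psi]. *)
pose y := to_completion (enlarge_form wp H) (x, 1 : B).
have psiE b : psi b = inner (enlarge_repr wp (dil_repr dil) b y) y.
  rewrite enlarge_reprE -[RHS]/(cinner _ _) cinnerE /= /pair_fs /= mulr1 star1 mul1r.
  by rewrite scaleN1r addrC subrK.
have I := maximal_intertwined (enlarge_dilation wp dil hS) hS hgen hpsi hmax psiE.
move=> b; have := I b; rewrite !enlarge_reprE !enlarge_mapE enlarge_reprE.
move=> /enlarge_fst_inj; rewrite /x !blinZ => /eqP.
rewrite -subr_eq0 -scalerBr scaler_eq0 subr_eq0 => /orP[|/eqP//].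
by move=> /eqP /complexI /eqP; rewrite (negbTE cn).
Qed.

End Dominated.

(** * Absolute continuity *)

Section UltraLimit.
Variable R : realType.
Variables (U : set_system nat) (UU : UltraFilter U).

(** The limit is the supremum of the numbers lying below [r] on a set of [U]; the ultrafilter
    property gives the estimate from above. *)
Let ultra_real (r : nat -> R) (M : R) : (forall n, `|r n| <= M) ->
  exists p, forall e : R, 0 < e -> U [set n | `|r n - p| < e].
Proof.
move=> rM; pose D := [set t : R | U [set n | t <= r n]].
have D1 : has_sup D.
  split.
    exists (- M); apply: filterS filterT => n _ /=.
    by have := rM n; rewrite ler_norml => /andP[].
  exists M => t Dt; have [n /= tn] := filter_ex Dt.
  by have := rM n; rewrite ler_norml => /andP[_]; exact: le_trans.
exists (sup D) => e e0; have [t Dt te] := sup_adherent e0 D1.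
have nD : ~ D (sup D + e).
  by move=> h; have h2 : sup D + e <= sup D := sup_upper_bound D1 h; lra.
have [h|h] := in_ultra_setVsetC [set n | sup D + e <= r n] UU; first by case: nD.
apply: filterS2 Dt h => n /= tn /negP; rewrite -ltNge => h.
by rewrite ltr_norml; apply/andP; split; lra.
Qed.

Definition ucvg (z : nat -> R[i]) (l : R[i]) :=
  forall e : R, 0 < e -> U [set n | fq (cform R) (z n - l) < e].

Lemma ucvg_unique z l m : ucvg z l -> ucvg z m -> l = m.
Proof.
move=> zl zm; apply/eqP; rewrite -subr_eq0; apply/eqP/normsq_eq0.
rewrite -cformE; apply/le_anti; rewrite fq_ge0 andbT leNgt; apply/negP => p.
have [n [/= h1 h2]] := filter_ex (filterI (zl _ (div4_gt0 p)) (zm _ (div4_gt0 p))).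
have := fqB_le (cform R) l (z n) m; rewrite (fqB _ _ (z n)).
by move: h1 h2 p; lra.
Qed.

Lemma ucvgP k z w l m : ucvg z l -> ucvg w m ->
  ucvg (fun n => k * z n + w n) (k * l + m).
Proof.
move=> zl wm e e0.
have p : 0 < e / (4 * (normsq k + 1)).
  by rewrite divr_gt0// mulr_gt0// ltr_wpDl// normsq_ge0.
apply: filterS2 (zl _ p) (wm _ (div4_gt0 e0)) => n /= h1 h2.
rewrite opprD addrACA -mulrBr (le_lt_trans (fqD_le _ _ _))//.
rewrite ltr_pdivlMr ?mulr_gt0 ?ltr_wpDl ?normsq_ge0// in h1.
move: h1 h2; rewrite !cformE normsqM.
have := normsq_ge0 (z n - l); have := normsq_ge0 k.
move: (normsq (z n - l)) (normsq k) (normsq (w n - m)) => a b c; nra.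
Qed.

Lemma ucvg_bounded z (M : R) : (forall n, normsq (z n) <= M ^+ 2) -> 0 <= M ->
  exists l, ucvg z l.
Proof.
move=> zM M0.
have b (x y : R) : x ^+ 2 + y ^+ 2 <= M ^+ 2 -> `|x| <= M /\ `|y| <= M.
  move=> h; rewrite !ler_norml; have := sqr_ge0 x; have := sqr_ge0 y.
  by split; apply/andP; split; nra.
have [p Hp] := @ultra_real (fun n => Re (z n)) M (fun n => (b _ _ (zM n)).1).
have [q Hq] := @ultra_real (fun n => Im (z n)) M (fun n => (b _ _ (zM n)).2).
exists (Complex p q) => e e0; pose d := Num.min 1 (e / 2).
have d0 : 0 < d by rewrite lt_min ltr01 divr_gt0.
apply: filterS2 (Hp _ d0) (Hq _ d0) => n /= h1 h2.
rewrite cformE /normsq !raddfB /=.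
have lt2 (x : R) : `|x| < d -> x ^+ 2 < e / 2.
  rewrite lt_min => /andP[x1 x2]; rewrite -real_normK ?num_real//.
  by have := normr_ge0 x; nra.
by have := lt2 _ h1; have := lt2 _ h2; lra.
Qed.

Lemma ucvg_le z l (M : R) : ucvg z l -> (forall n, normsq (z n) <= M ^+ 2) -> 0 <= M ->
  normsq l <= M ^+ 2.
Proof.
move=> zl zM M0; rewrite leNgt; apply/negP => Ml.
have e0 : 0 < ((Num.sqrt (normsq l) - M) / 2) ^+ 2.
  rewrite exprn_gt0// divr_gt0// subr_gt0 -[ltLHS]ger0_norm// -sqrtr_sqr ltr_sqrt//.
  exact: le_lt_trans (sqr_ge0 _) Ml.
have [n /= h] := filter_ex (zl _ e0).
have := @rnormB_trans _ R[i]^o l (z n) 0; rewrite !subr0.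
have E (x : R[i]) : @rnorm _ R[i]^o x = Num.sqrt (normsq x).
  by rewrite normsqE sqrtr_sqr ger0_norm//; exact: (@rnorm_ge0 _ R[i]^o).
rewrite rnormB !E; move: h; rewrite cformE => h.
have h1 : Num.sqrt (normsq (z n - l)) < (Num.sqrt (normsq l) - M) / 2.
  rewrite -(ltr_pXn2r (n := 2))// ?nnegrE ?sqrtr_ge0 ?sqr_sqrtr ?normsq_ge0//.
  rewrite divr_ge0// subr_ge0 -[leLHS]ger0_norm// -sqrtr_sqr ler_sqrt ?normsq_ge0//.
  exact: ltW.
have h2 : Num.sqrt (normsq (z n)) <= M.
  by rewrite -[leRHS]ger0_norm// -sqrtr_sqr ler_wsqrtr.
have h3 : M < Num.sqrt (normsq l).
  rewrite -[ltLHS]ger0_norm// -sqrtr_sqr ltr_sqrt//.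
  exact: le_lt_trans (sqr_ge0 _) Ml.
lra.
Qed.

End UltraLimit.

(** Limits along an ultrafilter finer than [\oo], taken functional by functional, are linear and
    bounded by [M]; where [g (z n)] converges, they agree with the ordinary limit. *)
Lemma bidual_limit (R : realType) (B : cstarAlgType R) (z : nat -> B) (M : R) :
  (forall n, rnorm (z n) <= M) ->
  exists x : bidual B, forall (g : dual B) l,
    fcvg (cform R) (fun n => g (z n) : R[i]) l -> x g = l.
Proof.
move=> zM; have M0 : 0 <= M by apply: le_trans (zM 0%N); exact: rnorm_ge0.
have [U [UU oU]] := @ultraFilterLemma nat (nbhs \oo) _.
have gM (g : dual B) n : normsq (g (z n)) <= (rnorm g * M) ^+ 2.
  have := blin_bound g (z n); rewrite !rnormE -rmorphM lecR => h.
  rewrite [leLHS](_ : _ = rnorm (g (z n)) ^+ 2); last by rewrite normsqE.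
  rewrite ler_pXn2r// ?nnegrE ?mulr_ge0 ?rnorm_ge0//.
  by apply: le_trans h _; rewrite ler_wpM2l ?rnorm_ge0.
have gM0 (g : dual B) : 0 <= rnorm g * M by rewrite mulr_ge0 ?rnorm_ge0.
have /choice[x Hx] : forall g : dual B, exists l, ucvg U (fun n => g (z n) : R[i]) l.
  by move=> g; exact: ucvg_bounded (gM g) (gM0 g).
have xl : linear (x : dual B -> R[i]^o).
  move=> k f g; apply: (ucvg_unique UU (Hx _)).
  exact: (ucvgP UU k (Hx f) (Hx g)).
have xb g : `|x g : R[i]^o| <= M%:C%C * `|g|.
  rewrite !rnormE -rmorphM lecR mulrC.
  rewrite -(ler_pXn2r (n := 2))// ?nnegrE ?rnorm_ge0//.
  rewrite [leLHS](_ : _ = normsq (x g)); last by rewrite normsqE.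
  exact: (ucvg_le UU (Hx g) (gM g) (gM0 g)).
exists (BLin xl (bounded_continuous xl xb)) => g l gl.
apply: (ucvg_unique UU (Hx g)) => e e0; apply: oU.
by have [N H] := gl _ e0; exists N.
Qed.

(** * Weak-* limits and the component orthogonal to dominated orbits *)

Section AbsolutelyContinuous.
Variables (R : realType) (B : cstarAlgType R).
Variables (H : hilbertType R) (pi : B -> blin H H) (hpi : star_representation pi).
Variables (phi psi : dual B) (xi e : H).
Hypothesis phiE : forall b, phi b = inner (pi b xi) xi.
Hypothesis psiE : forall b, psi b = inner (pi b e) e.
Hypothesis hac : absolutely_continuous phi psi.

Let s := hform H.
Let A := repr_action hpi.

(** Unfolding the Arens product lets the limit be taken in two stages: first in [bidual_act x g],
    then in the outer [x]. *)
Lemma bidual_square (x : bidual B) (g : dual B) :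
  bidual_ext g (bidual_mul (bidual_star x) x) =
  (x (dual_star (bidual_act x g)) : R[i])^*.
Proof. by []. Qed.

(** For a weak-* limit [x] of [z], the functional [x . psi] takes the values [<0, pi (star c) e>],
    so [x] is in the null ideal of [psi]. The star of [x . phi] is [c |-> <pi c xi, y>], on which
    [x] takes the value [<y, y>]; absolute continuity makes it 0. *)
Lemma ac_limit (z : nat -> B) (M : R) y : (forall n, rnorm (z n) <= M) ->
  fcvg s (fun n => pi (z n) xi) y -> fcvg s (fun n => pi (z n) e) 0 -> y = 0.
Proof.
move=> zM zxi ze; have [x Hx] := bidual_limit zM.
have lim v l (g : dual B) c : (forall b, g b = inner (pi b v) v) ->
    fcvg s (fun n => pi (z n) v) l -> x (dual_act g c) = s l (pi (star c) v).
  move=> gE zv; apply: Hx.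
  rewrite (_ : (fun n => _) = (fun n => s (pi (z n) v) (pi (star c) v))).
    exact: fcvg_fsl.
  by apply/funext => n; rewrite /= gE (reprME hpi) -hformE (repr_fs hpi).
have npsi : bidual_ext psi (bidual_mul (bidual_star x) x) = 0.
  rewrite bidual_square.
  have -> : bidual_act x psi = 0.
    apply: blinP => c; rewrite [LHS](lim e 0 _ _ psiE ze).
    exact: fs0l.
  have -> : dual_star (0 : dual B) = 0 by apply: blinP => c /=; rewrite rmorph0.
  by rewrite linear0 rmorph0.
have : bidual_ext phi (bidual_mul (bidual_star x) x) = 0 := hac npsi.
rewrite bidual_square => /eqP; rewrite fmorph_eq0 => /eqP.
rewrite (Hx _ (s y y)) => [yy|].
  by apply: (fq_hform_eq0); rewrite /fq -/s yy.
rewrite (_ : (fun n => _) = (fun n => s (pi (z n) xi) y)); first exact: fcvg_fsl.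
apply/funext => n; rewrite /= [X in X^*](lim xi y _ _ phiE zxi) starK.
by rewrite -fsC.
Qed.

Lemma ac_orth_dominated_eq0 f : orth_dominated psi A f ->
  (forall y, orth_dominated psi A y -> s (xi - f) y = 0) -> f = 0.
Proof.
move=> uf xf.
(* Being dominated, [e] has no component in [orth_dominated]; this is why its target below is 0. *)
have de : dominated psi A e.
  exists 1; split=> // b; rewrite mul1r /= psiE.
  by rewrite (reprME hpi) -hformE (repr_fs hpi) starK.
have oe y : orth_dominated psi A y -> s e y = 0.
  by move=> /(_ e 1 de) h; apply: fs_orthC; rewrite -[X in s _ X](repr1E hpi).
have sc := @hform_complete R H.
pose s3 := pair_form s (pair_form s s); pose A3 := pair_action A (pair_action A A).
have u0 : orth_dominated psi A 0 by exact: orth_dominated0.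
have /choice[b Hb] : forall n : nat, exists b, star b = b /\
    fq s3 (A3 b (xi, (f, e)) - (f, (f, 0))) < n.+1%:R^-1.
  move=> n; apply: (sa_orbit_approx (psi := psi)).
  - by apply: pair_complete => //; exact: pair_complete.
  - by apply: orth_dominated_pair => //; exact: orth_dominated_pair.
  - move=> y uy; have u1 := orth_dominated_pair1 uy.
    have u2 := orth_dominated_pair1 (orth_dominated_pair2 uy).
    have u3 := orth_dominated_pair2 (orth_dominated_pair2 uy).
    transitivity (s (xi - f) y.1 + (s (f - f) y.2.1 + s (e - 0) y.2.2)); first by [].
    by rewrite xf// subrr fs0l subr0 oe// !addr0.
  - by rewrite invr_gt0.
have /choice[w Hw] : forall n, exists w, [/\ w * (b n + 'i%C *: (1 : B)) = 1,
    (b n + 'i%C *: (1 : B)) * w = 1 & rnorm w <= 1].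
  by move=> n; apply: resolvent; exact: (Hb n).1.
have cvg1 : [/\ fcvg s (fun n => pi (b n) xi) f, fcvg s (fun n => pi (b n) f) f &
    fcvg s (fun n => pi (b n) e) 0].
  by split; apply: (fcvg_of_le (@natSinv_lt R)) => n;
    apply: le_trans (ltW (Hb n).2); rewrite !fq_pair /=;
    have := fq_ge0 s (pi (b n) xi - f); have := fq_ge0 s (pi (b n) f - f);
    have := fq_ge0 s (pi (b n) e - 0); rewrite /= ; lra.
have [bxi bf be] := cvg1.
have wb (u : nat -> H) : fcvg s u 0 -> fcvg s (fun n => pi (w n) (u n)) 0.
  move=> hu d d0; have [N HN] := hu _ d0; exists N => n /HN; rewrite !subr0.
  apply: le_lt_trans; apply: le_trans (repr_contractive hpi _ _) _.
  have [_ _ w1] := Hw n; apply: ler_piMl; first exact: fq_ge0.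
  by apply: exprn_ile1 => //; exact: rnorm_ge0.
(* From [f = w_n (b_n + i) f] one gets [f - w_n (b_n f - f) = (1 + i) w_n f], and the subtracted
   term tends to 0. *)
pose k : R[i] := 1 + 'i%C.
have k0 : k != 0.
  by apply/eqP => /(congr1 (@complex.Re R)) /=; rewrite addr0 => /eqP; rewrite oner_eq0.
have wf : fcvg s (fun n => pi (w n) f) (k^-1 *: f).
  have h : fcvg s (fun n => pi (w n) (pi (b n) f - f)) 0.
    by apply: wb; have := fcvgB bf (fcvg_cst s f); rewrite subrr.
  have := fcvgZ k^-1 (fcvgB (fcvg_cst s f) h); rewrite subr0.
  congr fcvg; apply/funext => n; have [wn _ _] := Hw n.
  have E : f = pi (w n) (pi (b n) f) + 'i%C *: pi (w n) f.
    rewrite -{1}(repr1E hpi f) -wn (reprME hpi) (reprDE hpi) (reprZE hpi) (repr1E hpi).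
    by rewrite linearD linearZ.
  have -> : f - pi (w n) (pi (b n) f - f) = k *: pi (w n) f.
    rewrite linearB /=; move: (pi (w n) (pi (b n) f)) (pi (w n) f) E => p q ->.
    by rewrite opprB addrC addrA subrK /k scalerDl scale1r.
  by rewrite scalerA mulVf// scale1r.
(* The [b n] carry no norm bound, whereas [z n = 1 - i w n] is bounded; this plays the part of
   Kaplansky density. *)
pose z n := w n * b n.
have zE n : z n = 1 - 'i%C *: w n.
  have [wn _ _] := Hw n; by rewrite -wn mulrDr -scalerArB mulr1 addrK.
have zM n : rnorm (z n) <= rnorm (1 : B) + 1.
  rewrite zE; apply: le_trans (rnormB_le _ _) _; rewrite lerD2l rnormZ /normsq /=.
  by rewrite expr0n expr1n add0r sqrtr1 mul1r; case: (Hw n).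
have : k^-1 *: f = 0.
  apply: (ac_limit zM).
    have h : fcvg s (fun n => pi (w n) (pi (b n) xi - f)) 0.
      by apply: wb; have := fcvgB bxi (fcvg_cst s f); rewrite subrr.
    have := fcvgD h wf; rewrite add0r; congr fcvg; apply/funext => n.
    by rewrite /z (reprME hpi) linearB subrK.
  have := wb _ be; congr fcvg; apply/funext => n.
  by rewrite /z (reprME hpi).
by move/eqP; rewrite scaler_eq0 invr_eq0 (negbTE k0) => /eqP.
Qed.

End AbsolutelyContinuous.

Theorem theorem4p4 (R : realType) (B : cstarAlgType R) (S : set B)
    (hS : operator_system S) (hgen : cstar_generated S = [set: B])
    (phi psi : dual B) (hphi : is_state phi) (hpsi : is_state psi)
    (hac : absolutely_continuous phi psi) :
  dilation_maximal S psi -> dilation_maximal S phi.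
Proof.
move=> hmax chi [_ _ [H [K [pi [xi [sigma [eta [V [Vs [rphi rchi [Viso Vxi] Vadj Vdil]]]]]]]]]].
have [hpi nxi phiE] := rphi; have [hsigma _ chiE] := rchi.
have dil : dilation S pi sigma V Vs by [].
have S1 : S 1 by case: hS.
suff I : intertwined pi sigma V xi.
  apply: blinP => b; rewrite chiE phiE -Vxi I Vadj.
  by rewrite (dilation_cancel dil _ S1).
(* Adjoining the GNS space of [psi] itself puts a vector for [phi] and one for [psi] into one
   representation. *)
have wp := hpsi.1.
have dL := enlarge_dilation wp dil hS.
set P := enlarge_repr wp _ in dL; set P' := enlarge_repr wp _ in dL.
set W := enlarge_map wp _ in dL.
pose jxi := to_completion (enlarge_form wp H) (xi, 0 : B).
pose e := to_completion (enlarge_form wp H) (0 : H, 1 : B).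
have phiL b : phi b = inner (P b jxi) jxi.
  rewrite /P /jxi enlarge_reprE -[RHS]/(cinner _ _) cinnerE /= /pair_fs /=.
  by rewrite !mulr0 linear0 addr0 phiE.
have psiL b : psi b = inner (P b e) e.
  rewrite /P /e enlarge_reprE -[RHS]/(cinner _ _) cinnerE /= /pair_fs /=.
  by rewrite -hformE fs0r add0r star1 mul1r mulr1.
pose A := repr_action (dil_repr dL).
have sc := @hform_complete R (enlarge wp H).
have [f [uf xf]] := orth_dominated_split psi A sc jxi.
have f0 := ac_orth_dominated_eq0 phiL psiL hac uf xf.
have [y [[u [Xu uy]] Hy]] := complex_projection sc jxi (intertwined0 P P' W)
  (@intertwinedP _ _ _ _ P P' W).
have Iy : intertwined P P' W y by exact: (intertwined_closed dL uy).
(* The residual is orthogonal to all intertwined vectors, and dominated orbits consist of such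
   vectors. As [f = 0], [jxi] is then orthogonal to the residual, as is [y], so the residual is
   0. *)
have ury : orth_dominated psi A (jxi - y).
  move=> z b dz; apply: Hy; apply: (intertwined_act dL).
  exact: (@dominated_intertwined _ _ _ hS hgen psi hpsi hmax _ _ _ _ _ _ dL z dz).
have jy : jxi = y.
  apply/eqP; rewrite -subr_eq0; apply/eqP/fq_hform_eq0.
  have := xf _ ury; rewrite f0 subr0 => h.
  by rewrite /fq fsBl h sub0r (fs_orthC (Hy _ Iy)) oppr0.
move=> b; have := Iy b; rewrite -jy /P /P' /W /jxi !enlarge_reprE !enlarge_mapE enlarge_reprE.
exact: enlarge_fst_inj.
Qed.
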